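(* Let $n$ be a positive integer. If $T_1,\ldots,T_n\in B(\mathcal H)$, then (i) $\sigma_r(T_1,\ldots,T_n)\subseteq\overline{W(T_1,\ldots,T_n)}\subseteq\overline{(\mathbb C^n)}_{w_e(T_1,\ldots,T_n)}\subseteq\overline{(\mathbb C^n)}_{w(T_1,\ldots,T_n)}\subseteq\overline{(\mathbb C^n)}_{\|[T_1,\ldots,T_n]\|}$; (ii) $\sigma_r(T_1,\ldots,T_n)\subseteq\overline{(\mathbb C^n)}_{r(T_1,\ldots,T_n)}\subseteq\overline{(\mathbb C^n)}_{w(T_1,\ldots,T_n)}$; (iii) $\sigma_r(T_1,\ldots,T_n)$ is a compact subset of $\mathbb C^n$.
   Context: $\mathcal H$ is a complex Hilbert space. $\overline{(\mathbb C^n)}_s=\{(\lambda_1,\ldots,\lambda_n)\in\mathbb C^n:\sum|\lambda_i|^2\le s^2\}$ for $s\ge0$. The joint right spectrum $\sigma_r(T_1,\ldots,T_n)$ is the set of all $(\lambda_1,\ldots,\lambda_n)\in\mathbb C^n$ such that the right ideal of $B(\mathcal H)$ generated by $\lambda_1I-T_1,\ldots,\lambda_nI-T_n$ does not contain the identity. Joint numerical range: $W(T_1,\ldots,T_n):=\{(\langle T_1h,h\rangle,\ldots,\langle T_nh,h\rangle):h\in\mathcal H,\|h\|=1\}$. Euclidean operator radius: $w_e(T_1,\ldots,T_n):=\sup_{\|h\|=1}\left(\sum_i|\langle T_ih,h\rangle|^2\right)^{1/2}$. $\mathbb F_n^+$ is the unital free semigroup on $g_1,\ldots,g_n$; $T_\alpha=T_{i_1}\cdots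 T_{i_k}$, $|\alpha|=k$ for $\alpha=g_{i_1}\cdots g_{i_k}$. Joint numerical radius: $w(T_1,\ldots,T_n):=\sup\left|\sum_{\alpha\in\mathbb F_n^+}\sum_{j=1}^n\langle h_\alpha,T_jh_{g_j\alpha}\rangle\right|$ over families $\{h_\alpha\}\subset\mathcal H$ with $\sum_\alpha\|h_\alpha\|^2=1$. Joint spectral radius: $r(T_1,\ldots,T_n):=\lim_k\left\|\sum_{|\alpha|=k}T_\alpha T_\alpha^*\right\|^{1/2k}$. $\|[T_1,\ldots,T_n]\|=\|\sum T_iT_i^*\|^{1/2}$. *)

(* Defs.v *)
From HB Require Import structures.
From mathcomp Require Import all_boot all_order all_algebra.
From mathcomp Require Import sesquilinear complex.
From mathcomp Require Import all_classical all_reals all_analysis.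
From mathcomp Require summability.
Import Order.TTheory GRing.Theory Num.Theory.
Import numFieldNormedType.Exports.

Set Implicit Arguments.
Unset Strict Implicit.
Unset Printing Implicit Defensive.

Local Open Scope classical_set_scope.
Local Open Scope ring_scope.
Local Open Scope complex_scope.

(* Norms of normed spaces over R[i] take their values in R[i] (they are
   nonnegative reals there); rnorm is the same number as an element of R. *)
Definition rnorm (R : realType) (V : normedZmodType R[i]) (x : V) : R :=
  complex.Re `|x|.

Section BoundedOperators.
Variables (R : realType) (H : completeNormedModType R[i]).

(* B(H), as a set of functions *)
Definition bounded_op : set (H -> H) :=
  [set A : H -> H | linear A /\
    exists M : R, forall x, rnorm (A x) <= M * rnorm x].

Definition opnorm (A : H -> H) : R :=
  sup [set rnorm (A x) | x in [set x : H | rnorm x <= 1]].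

(* Closure under opposites and scalars follows from the last clause, by taking
   for X a multiple of the identity. *)
Definition right_ideal (J : set (H -> H)) : Prop :=
  [/\ J `<=` bounded_op,
      J (fun=> 0),
      forall A B, J A -> J B -> J (A \+ B) &
      forall A X, J A -> bounded_op X -> J (A \o X)].

Definition right_ideal_gen (S : set (H -> H)) : set (H -> H) :=
  smallest right_ideal S.

Section Tuples.
Variables (n : nat) (T : 'I_n -> H -> H).

(* The coefficients are in R[i]^o because that alias of R[i] carries the usual
   topology, hence 'rV[R[i]^o]_n the product topology of C^n. *)
Definition right_spectrum : set 'rV[R[i]^o]_n :=
  [set l : 'rV[R[i]^o]_n |
    ~ right_ideal_gen
        (range (fun i : 'I_n => fun x : H => l 0 i *: x - T i x)) id].

(* The free semigroup on g_1, ..., g_n is the set of words seq 'I_n, the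
   neutral element being the empty word and g_j alpha being j :: alpha. *)
Definition word_op (alpha : seq 'I_n) : H -> H :=
  foldr (fun i A => T i \o A) id alpha.

End Tuples.

Section InnerProduct.
Variable dot : {dot H for Num.conj}. (* linear in its first argument *)

(* When dot induces the norm of H, the adjoint of a bounded operator A exists
   and is unique by the Riesz representation theorem, so the default value
   0 is only used for functions A which are not bounded operators. *)
Definition adjoint (A : H -> H) : H -> H :=
  xget (fun=> 0)
    [set B : H -> H | bounded_op B /\ forall x y, dot (A x) y = dot x (B y)].

Variables (n : nat) (T : 'I_n -> H -> H).

Definition numerical_range : set 'rV[R[i]^o]_n :=
  [set \row_i (dot (T i h) h : R[i]^o) | h in [set h : H | rnorm h = 1]].

Definition euclidean_radius : R :=
  sup [set Num.sqrt (\sum_i rnorm (dot (T i h) h) ^+ 2)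
      | h in [set h : H | rnorm h = 1]].

(* summability.sum is the unordered sum, i.e. the limit of the finite partial
   sums along the directed set of finite sets of words; here it converges
   absolutely. *)
Definition numerical_radius : R :=
  sup [set rnorm (summability.sum
             (fun alpha : seq 'I_n =>
                \sum_(j < n) dot (h alpha) (T j (h (j :: alpha))) : R[i]^o))
      | h in [set h : seq 'I_n -> H |
               (\esum_(alpha in [set: seq 'I_n])
                  (rnorm (h alpha) ^+ 2)%:E)%E = 1%E]].

Definition spectral_radius : R :=
  lim ((fun k : nat =>
          opnorm (fun x => \sum_(alpha : k.-tuple 'I_n)
                             word_op T alpha (adjoint (word_op T alpha) x))
          `^ ((2 * k)%N%:R^-1)) @ \oo).

Definition row_norm : R :=
  Num.sqrt (opnorm (fun x => \sum_(i < n) T i (adjoint (T i) x))).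

End InnerProduct.
End BoundedOperators.

(* meant for s >= 0 *)
Definition closed_ball_Cn (R : realType) (n : nat) (s : R) :
    set 'rV[R[i]^o]_n :=
  [set l : 'rV[R[i]^o]_n | \sum_(i < n) rnorm (l 0 i) ^+ 2 <= s ^+ 2].

(* Main.v *)
(** The statements on the spectrum reduce to right inverses given by Neumann series.

A point l lies outside the right spectrum iff sum_i (l_i - T_i) X_i = 1 for some
bounded X_i. This is stable under small perturbations of l, so the spectrum is
closed. It holds when sum_i |(l_i - T_i)^* h|^2 >= c |h|^2, since then
1 - t sum_i (l_i - T_i)(l_i - T_i)^* is a contraction for small t; so a point of
the spectrum has unit vectors h almost annihilated by all (l_i - T_i)^*, for
which (<T_i h, h>)_i is close to l. It also holds when |l| > r(T), since then
(sum_i conj(l_i) T_i / |l|^2)^k is a contraction for some k.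

The constant |sum_(|w| = k) T_w T_w^*| is the least c such that
|sum_w T_w x_w|^2 <= c sum_w |x_w|^2 for all families x; hence it is
submultiplicative in k, and bounds on it come from test families. The inequalities
w_e <= w and r <= w are obtained by evaluating the form that defines w at
explicit families supported on words of bounded length. *)
Require Import Defs.
From HB Require Import structures.
From mathcomp Require Import all_boot all_order all_algebra.
From mathcomp Require Import sesquilinear complex.
From mathcomp Require Import all_classical all_reals all_analysis.
From mathcomp Require summability.
From mathcomp Require Import finmap lra ring zify.
Import Order.TTheory GRing.Theory Num.Theory.
Import numFieldNormedType.Exports.

Local Open Scope classical_set_scope.
Local Open Scope ring_scope.
Local Open Scope complex_scope.

(** * Real-valued norms over the complex scalars *)

Section Norms.
Context {R : realType}.

Lemma rnormE (V : normedZmodType R[i]) (x : V) : `|x| = (rnorm x)%:C.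
Proof. by rewrite /rnorm RRe_real// normr_real. Qed.

Lemma rnorm_ge0 (V : normedZmodType R[i]) (x : V) : 0 <= rnorm x.
Proof. by rewrite -ler0c -rnormE. Qed.

Lemma rnorm0 (V : normedZmodType R[i]) : rnorm (0 : V) = 0.
Proof. by rewrite /rnorm normr0. Qed.

Lemma rnorm_eq0 (V : normedZmodType R[i]) (x : V) : rnorm x = 0 -> x = 0.
Proof. by move=> x0; apply/eqP; rewrite -normr_eq0 rnormE x0. Qed.

Lemma rnormN (V : normedZmodType R[i]) (x : V) : rnorm (- x) = rnorm x.
Proof. by rewrite /rnorm normrN. Qed.

Lemma rnorm_distC (V : normedZmodType R[i]) (x y : V) :
  rnorm (x - y) = rnorm (y - x).
Proof. by rewrite /rnorm distrC. Qed.

Lemma rnormD (V : normedZmodType R[i]) (x y : V) :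
  rnorm (x + y) <= rnorm x + rnorm y.
Proof. by rewrite -lecR rmorphD/= -!rnormE ler_normD. Qed.

Lemma rnorm_sum (V : normedZmodType R[i]) (I : Type) (r : seq I) (P : pred I)
    (F : I -> V) :
  rnorm (\sum_(i <- r | P i) F i) <= \sum_(i <- r | P i) rnorm (F i).
Proof.
elim/big_ind2 : _ => [|x a y b xa yb|//]; first by rewrite rnorm0.
by rewrite (le_trans (rnormD _ _ _))// lerD.
Qed.

Lemma rnormM (x y : R[i]) : rnorm (x * y) = rnorm x * rnorm y.
Proof. by apply: complexI; rewrite rmorphM/= -!rnormE normrM. Qed.

Lemma rnormZ (V : normedModType R[i]) (a : R[i]) (x : V) :
  rnorm (a *: x) = rnorm a * rnorm x.
Proof. by apply: complexI; rewrite rmorphM/= -!rnormE normrZ. Qed.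

Lemma rnormC (r : R) : rnorm r%:C = `|r|.
Proof. by rewrite /rnorm normc_def/= expr0n addr0 sqrtr_sqr. Qed.

Lemma rnormC_ge0 (r : R) : 0 <= r -> rnorm r%:C = r.
Proof. by move=> r0; rewrite rnormC ger0_norm. Qed.

Lemma rnormJ (x : R[i]) : rnorm x^* = rnorm x.
Proof. by rewrite /rnorm normcJ. Qed.

Lemma rnorm_i : rnorm ('i : R[i]) = 1.
Proof. by rewrite /rnorm normc_def/= expr0n/= add0r expr1n sqrtr1. Qed.

Lemma rnorm_prod (I : Type) (r : seq I) (c : I -> R[i]) :
  rnorm (\prod_(i <- r) c i) = \prod_(i <- r) rnorm (c i).
Proof.
elim: r => [|i r IH]; last by rewrite !big_cons rnormM IH.
by rewrite !big_nil -(rmorph1 (real_complex R)) rnormC normr1.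
Qed.

Lemma sqr_rnorm (x : R[i]) : (rnorm x ^+ 2)%:C = x * x^*.
Proof. by rewrite rmorphXn/= -rnormE sqr_normc. Qed.

Lemma Re_le_rnorm (x : R[i]) : `|complex.Re x| <= rnorm x.
Proof. by rewrite -lecR -rnormE normc_ge_Re. Qed.

(** A positive element of [R[i]] has zero imaginary part, so completeness of [V] can be used with
    real tolerances. *)
Lemma rnorm_cauchy_cvg (V : completeNormedModType R[i]) (u : nat -> V) :
  (forall e : R, 0 < e -> exists N, forall m k, (N <= m)%N -> (N <= k)%N ->
    rnorm (u m - u k) <= e) ->
  exists l, forall e : R, 0 < e -> exists N, forall k, (N <= k)%N ->
    rnorm (u k - l) <= e.
Proof.
move=> ucauchy.
have gt0C (e : R[i]) : 0 < e -> exists2 r : R, 0 < r & e = r%:C.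
  by case: e => a b; rewrite ltcE/= => /andP[/eqP-> a0]; exists a.
have /cvg_ex[l ul] : cvg (u @ \oo).
  apply: cauchy_cvg; apply: cauchy_exP => _ /gt0C[r r0 ->].
  have /ucauchy[N uN] : 0 < r / 2 by rewrite divr_gt0.
  exists (u N); exists N => // k /= Nk.
  rewrite -ball_normE/= rnormE ltcR (le_lt_trans (uN _ _ _ Nk))//.
  by rewrite ltr_pdivrMr// ltr_pMr// ltr1n.
exists l => e e0.
move/cvgrPdist_le: ul => /(_ e%:C); rewrite ltcR => /(_ e0)[N _ uN].
by exists N => k /uN /=; rewrite rnorm_distC rnormE lecR.
Qed.

End Norms.

(** * Bounded operators, the operator norm and Neumann series *)

Section BoundedOperators.
Context {R : realType} {H : completeNormedModType R[i]}.
Implicit Types A B D X : H -> H.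

Lemma bopD {A} : bounded_op A -> {morph A : x y / x + y}.
Proof. by case=> lA _ x y; have := lA 1 x y; rewrite !scale1r. Qed.

Lemma bop0 {A} : bounded_op A -> A 0 = 0.
Proof.
by move=> hA; apply: (addrI (A 0)); rewrite -(bopD hA) !addr0.
Qed.

Lemma bopZ {A} : bounded_op A -> forall a, {morph A : x / a *: x}.
Proof.
by move=> hA a x; have /= := hA.1 a x 0; rewrite (bop0 hA) !addr0.
Qed.

Lemma bopN {A} : bounded_op A -> {morph A : x / - x}.
Proof. by move=> hA x; rewrite -scaleN1r (bopZ hA) scaleN1r. Qed.

Lemma bopB {A} : bounded_op A -> {morph A : x y / x - y}.
Proof. by move=> hA x y; rewrite (bopD hA) (bopN hA). Qed.

Lemma bop_sum {A} (I : Type) (r : seq I) (P : pred I) (F : I -> H) :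
  bounded_op A ->
  A (\sum_(i <- r | P i) F i) = \sum_(i <- r | P i) A (F i).
Proof.
by move=> hA; rewrite (big_morph A (bopD hA) (bop0 hA)).
Qed.

Lemma bop_bound {A} : bounded_op A ->
  exists2 M : R, 0 < M & forall x, rnorm (A x) <= M * rnorm x.
Proof.
move=> [_ [M AM]]; exists (Num.max M 1); first by rewrite lt_max ltr01 orbT.
move=> x; apply: le_trans (AM x) _.
by rewrite ler_wpM2r ?rnorm_ge0// le_max lexx.
Qed.

Lemma bopI A (M : R) : {morph A : x y / x + y} ->
  (forall a, {morph A : x / a *: x}) ->
  (forall x, rnorm (A x) <= M * rnorm x) -> bounded_op A.
Proof. by move=> AD AZ AM; split; [move=> a x y; rewrite AD AZ|exists M]. Qed.

Lemma bounded_op_id : bounded_op (id : H -> H).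
Proof. by apply: (@bopI _ 1) => // x; rewrite mul1r. Qed.

Lemma bounded_op0 : bounded_op (fun=> 0 : H).
Proof.
apply: (@bopI _ 0) => [x y|a x|x]; first by rewrite addr0.
- by rewrite scaler0.
- by rewrite rnorm0 mul0r.
Qed.

Lemma bounded_op_add A B : bounded_op A -> bounded_op B -> bounded_op (A \+ B).
Proof.
move=> hA hB; have [M _ AM] := bop_bound hA; have [N _ BN] := bop_bound hB.
apply: (@bopI _ (M + N)) => [x y|a x|x] /=.
- by rewrite (bopD hA) (bopD hB) addrACA.
- by rewrite (bopZ hA) (bopZ hB) scalerDr.
- by rewrite mulrDl (le_trans (rnormD _ _ _))// lerD.
Qed.

Lemma bounded_op_scale (a : R[i]) A :
  bounded_op A -> bounded_op (fun x => a *: A x).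
Proof.
move=> hA; have [M _ AM] := bop_bound hA.
apply: (@bopI _ (rnorm a * M)) => [x y|b x|x] /=.
- by rewrite (bopD hA) scalerDr.
- by rewrite (bopZ hA) !scalerA mulrC.
- by rewrite rnormZ -mulrA ler_wpM2l ?rnorm_ge0.
Qed.

Lemma bounded_op_comp A B : bounded_op A -> bounded_op B -> bounded_op (A \o B).
Proof.
move=> hA hB; have [M M0 AM] := bop_bound hA.
have [N _ BN] := bop_bound hB.
apply: (@bopI _ (M * N)) => [x y|a x|x] /=.
- by rewrite (bopD hB) (bopD hA).
- by rewrite (bopZ hB) (bopZ hA).
- by rewrite (le_trans (AM _))// -mulrA ler_wpM2l// ltW.
Qed.

Lemma bounded_op_sub A B : bounded_op A -> bounded_op B ->
  bounded_op (fun x => A x - B x).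
Proof.
move=> hA hB.
have := bounded_op_add _ _ hA (bounded_op_scale (-1) _ hB).
by congr bounded_op; apply/funext => x /=; rewrite scaleN1r.
Qed.

Lemma bounded_op_sum (I : Type) (r : seq I) (P : pred I) (F : I -> H -> H) :
  (forall i, bounded_op (F i)) ->
  bounded_op (fun x => \sum_(i <- r | P i) F i x).
Proof.
move=> hF; elim: r => [|i r IH].
  by under eq_fun do rewrite big_nil; exact: bounded_op0.
under eq_fun do rewrite big_cons; case: (P i) => //.
exact: bounded_op_add.
Qed.

Lemma opnorm_has_ub A : bounded_op A ->
  has_ubound [set rnorm (A x) | x in [set x : H | rnorm x <= 1]].
Proof.
move=> /bop_bound[M M0 AM]; exists M => _ [x /= x1 <-].
by rewrite (le_trans (AM _))// ler_piMr// ltW.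
Qed.

Lemma opnorm_ge0 A : bounded_op A -> 0 <= opnorm A.
Proof.
move=> hA; rewrite -(rnorm0 H) -[X in rnorm X](bop0 hA).
apply: ub_le_sup; first exact: opnorm_has_ub.
by exists 0 => //=; rewrite rnorm0 ler01.
Qed.

Lemma le_opnorm A x : bounded_op A -> rnorm (A x) <= opnorm A * rnorm x.
Proof.
move=> hA; have [x0|x0] := eqVneq (rnorm x) 0.
  by rewrite x0 mulr0 (rnorm_eq0 _ _ x0) (bop0 hA) rnorm0.
have {}x0 : 0 < rnorm x by rewrite lt_neqAle eq_sym x0 rnorm_ge0.
rewrite -ler_pdivrMr//; apply: ub_le_sup; first exact: opnorm_has_ub.
exists ((rnorm x)^-1%:C *: x) => /=.
  by rewrite rnormZ rnormC_ge0 ?invr_ge0 ?rnorm_ge0// mulVf// gt_eqF.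
by rewrite (bopZ hA) rnormZ rnormC_ge0 ?invr_ge0 ?rnorm_ge0// mulrC.
Qed.

Lemma opnorm_le A (c : R) : 0 <= c -> (forall x, rnorm (A x) <= c * rnorm x) ->
  opnorm A <= c.
Proof.
move=> c0 Ac; apply: ge_sup => [|_ [x /= x1 <-]].
  by exists (rnorm (A 0)); exists 0 => //=; rewrite rnorm0 ler01.
by rewrite (le_trans (Ac _))// ler_piMr.
Qed.

(* The right inverse maps x to the fixed point of the contraction
   y |-> x + D y, obtained by iteration from 0. *)
Lemma neumann D (q : R) : bounded_op D -> q < 1 ->
  (forall x, rnorm (D x) <= q * rnorm x) ->
  exists2 X, bounded_op X & forall x, X x - D (X x) = x.
Proof.
move=> hD q1' Dq'.
(* [q] may be nonpositive; the maximum of [q] and [1 / 2] is still a bound below 1. *)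
wlog q0 : q q1' Dq' / 0 < q.
  move=> /(_ (Num.max q (1 / 2))); apply.
  - by rewrite gt_max q1' ltr_pdivrMr// mul1r ltr1n.
  - by move=> x; rewrite (le_trans (Dq' x))// ler_wpM2r ?rnorm_ge0// le_max lexx.
  - by rewrite lt_max divr_gt0// orbT.
rename q1' into q1; rename Dq' into Dq.
have uq : 0 < 1 - q by rewrite subr_gt0.
pose p x k := iter k (fun y => x + D y) 0.
have pS x k : p x k.+1 = x + D (p x k) by [].
(* The bound is the fixed point of [t |-> |x| + q t]. *)
have p_bound x k : rnorm (p x k) <= rnorm x / (1 - q).
  elim: k => [|k IH]; first by rewrite /p/= rnorm0 divr_ge0 ?rnorm_ge0 ?ltW.
  rewrite pS (le_trans (rnormD _ _ _))//.
  rewrite -lerBrDl (le_trans (Dq _))//.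
  rewrite (le_trans (ler_wpM2l (ltW q0) IH))// lerBrDl -lerBrDr.
  rewrite -[X in X - _]mul1r -mulrBl mulrCA mulfV ?mulr1// gt_eqF//.
have p_diff x m k : rnorm (p x (k + m)%N - p x k) <= q ^+ k * (rnorm x / (1 - q)).
  elim: k => [|k IH]; first by rewrite add0n expr0 mul1r /p/= subr0 p_bound.
  rewrite addSn !pS opprD addrACA subrr add0r -(bopB hD) (le_trans (Dq _))//.
  by rewrite exprS -mulrA ler_wpM2l// ltW.
have /choice[X hX] x : exists l, forall e : R, 0 < e ->
    exists N, forall k, (N <= k)%N -> rnorm (p x k - l) <= e.
  apply: rnorm_cauchy_cvg => e e0.
  have /cvgrPdist_le/(_ e e0)[N _ HN] :
      (fun k => q ^+ k * (rnorm x / (1 - q))) @ \oo --> 0.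
    rewrite -(mul0r (rnorm x / (1 - q))); apply: cvgM; last exact: cvg_cst.
    by apply: cvg_expr; rewrite ger0_norm// ltW.
  have key m k : (N <= k)%N -> (k <= m)%N -> rnorm (p x m - p x k) <= e.
    move=> Nk km; rewrite -(subnKC km) (le_trans (p_diff _ _ _))//.
    have := HN k Nk; rewrite /= sub0r normrN ger0_norm//.
    by rewrite mulr_ge0 ?exprn_ge0 ?divr_ge0 ?rnorm_ge0// ltW.
  exists N => m k Nm Nk; have [km|/ltnW mk] := leqP k m; first exact: key.
  by rewrite rnorm_distC key.
have XE x : X x - D (X x) = x.
  apply/eqP; rewrite -subr_eq0; apply/eqP/rnorm_eq0/eqP.
  rewrite eq_le rnorm_ge0 andbT; apply/ler_addgt0Pr => e e0; rewrite add0r.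
  have /(hX x)[N HN] : 0 < e / 2 by rewrite divr_gt0.
  (* Since [p x N.+1 = x + D (p x N)], the defect is controlled by the distances of two consecutive
     iterates to the limit. *)
  have -> : X x - D (X x) - x = D (p x N - X x) - (p x N.+1 - X x).
    by rewrite pS (bopB hD) opprB [RHS]addrC opprD !addrA subrK addrAC.
  rewrite (le_trans (rnormD _ _ _))// rnormN (splitr e) lerD ?HN//.
  rewrite (le_trans (Dq _))// (le_trans _ (HN N _))// ler_piMl ?rnorm_ge0//.
  exact: ltW.
(* Injectivity of [1 - D] makes [X x] the only solution, so that linearity of [X] follows from that
   of [D]. *)
have D_inj x : x - D x = 0 -> x = 0.
  move=> /subr0_eq xD; apply: rnorm_eq0; apply/eqP; rewrite eq_le rnorm_ge0 andbT.
  have := Dq x; rewrite -xD -subr_le0 -[X in X - _]mul1r -mulrBl.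
  by rewrite pmulr_rle0.
have uniq y x : y - D y = x -> y = X x.
  move=> yx; apply/subr0_eq/D_inj.
  by rewrite (bopB hD) opprD addrACA -opprD yx XE subrr.
exists X => //; apply: (@bopI _ (1 - q)^-1) => [x y|a x|x].
- by apply/esym/uniq; rewrite (bopD hD) opprD addrACA !XE.
- by apply/esym/uniq; rewrite (bopZ hD) -scalerBr XE.
- rewrite ler_pdivlMl// mulrBl mul1r -{3}(XE x) lerBlDr.
  rewrite -{1}(subrK (D (X x)) (X x)) (le_trans (rnormD _ _ _))//.
  by rewrite lerD2l.
Qed.

End BoundedOperators.

(** * Cauchy-Schwarz, Riesz representation and adjoints *)

Section InnerProduct.
Context {R : realType} {H : completeNormedModType R[i]}.
Context {dot : {dot H for Num.conj}}.
Hypothesis dot_norm : forall x : H, dot x x = `|x| ^+ 2.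
Implicit Types (x y z : H) (A B : H -> H).

Local Notation "''[' x , y ]" := (dot x y) : ring_scope.

Lemma dotDl x y z : '[x + y, z] = '[x, z] + '[y, z].
Proof. by rewrite linearDl. Qed.

Lemma dotDr x y z : '[x, y + z] = '[x, y] + '[x, z].
Proof. by rewrite linearDr. Qed.

Lemma dotBl x y z : '[x - y, z] = '[x, z] - '[y, z].
Proof. by rewrite linearBl. Qed.

Lemma dotBr x y z : '[x, y - z] = '[x, y] - '[x, z].
Proof. by rewrite linearBr. Qed.

Lemma dotZl a x y : '[a *: x, y] = a * '[x, y].
Proof. by rewrite linearZl_LR. Qed.

Lemma dotZr a x y : '[x, a *: y] = a^*%C * '[x, y].
Proof. by rewrite linearZr_LR. Qed.

Lemma dotNr x y : '[x, - y] = - '[x, y].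
Proof. by rewrite linearNr. Qed.

Lemma dot0r x : '[x, 0] = 0.
Proof. by rewrite linear0r. Qed.

Lemma dot_suml (I : Type) (r : seq I) (P : pred I) (F : I -> H) x :
  '[\sum_(i <- r | P i) F i, x] = \sum_(i <- r | P i) '[F i, x].
Proof. by rewrite linear_sumlz. Qed.

Lemma dot_sumr (I : Type) (r : seq I) (P : pred I) (F : I -> H) x :
  '[x, \sum_(i <- r | P i) F i] = \sum_(i <- r | P i) '[x, F i].
Proof. by rewrite linear_sumr. Qed.

Lemma dotC x y : '[x, y] = '[y, x]^*%C.
Proof. by rewrite (hermC dot x y) expr0 mul1r. Qed.

Lemma dotxx x : '[x, x] = (rnorm x ^+ 2)%:C.
Proof. by rewrite dot_norm rnormE rmorphXn. Qed.

Lemma rnorm_sqrD x y :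
  rnorm (x + y) ^+ 2 = rnorm x ^+ 2 + rnorm y ^+ 2 + 2 * complex.Re '[x, y].
Proof.
apply: complexI; rewrite -dotxx dotDl !dotDr (dotC y x).
by rewrite !rmorphD (rmorphM _ 2) rmorph_nat -addcJ/= -!dotxx; ring.
Qed.

Lemma CauchySchwarz_rnorm x y : rnorm '[x, y] <= rnorm x * rnorm y.
Proof.
have [y0|y0] := eqVneq (rnorm y) 0.
  by rewrite (rnorm_eq0 _ _ y0) dot0r !rnorm0 mulr0.
have {}y0 : 0 < rnorm y by rewrite lt_neqAle eq_sym y0 rnorm_ge0.
rewrite -(@ler_pXn2r _ 2)// ?nnegrE ?mulr_ge0 ?rnorm_ge0//.
have y2 : 0 < rnorm y ^+ 2 by rewrite exprn_gt0.
(* [a *: y] is the orthogonal projection of [x] on the line spanned by [y]. *)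
pose a := '[x, y] * (rnorm y ^- 2)%:C.
have : 0 <= rnorm (x - a *: y) ^+ 2 by rewrite sqr_ge0.
rewrite rnorm_sqrD rnormN rnormZ -scaleNr dotZr.
have -> : complex.Re ((- a)^*%C * '[x, y]) = - (rnorm '[x, y] ^+ 2 / rnorm y ^+ 2).
  have -> : (- a)^*%C = - ('[x, y]^*%C * (rnorm y ^- 2)%:C).
    by rewrite rmorphN rmorphM; congr (- (_ * _)); exact: conjc_real.
  rewrite mulNr mulrAC (mulrC _^*%C) -sqr_rnorm.
  by rewrite -rmorphM.
have -> : rnorm a = rnorm '[x, y] / rnorm y ^+ 2.
  by rewrite /a rnormM rnormC_ge0// invr_ge0 ltW.
rewrite !exprMn exprVn => /mulr_ge0/(_ (ltW y2)).
set p := rnorm x; set q := rnorm y; set r := rnorm '[x, y].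
have -> : (p ^+ 2 + r ^+ 2 * (q ^+ 2) ^- 2 * q ^+ 2 +
  2 * - (r ^+ 2 / q ^+ 2)) * q ^+ 2 = p ^+ 2 * q ^+ 2 - r ^+ 2.
  by field; rewrite gt_eqF.
by rewrite subr_ge0.
Qed.

Lemma dot_inj x y : (forall z, '[z, x] = '[z, y]) -> x = y.
Proof.
move=> xy; apply/subr0_eq/rnorm_eq0; apply/eqP; rewrite -sqrf_eq0; apply/eqP.
by apply: complexI; rewrite -dotxx dotBr xy subrr.
Qed.

(* [f] is represented by the minimizer of [|x|^2 - 2 Re (f x)]: minimizing
   sequences are Cauchy by the parallelogram law. *)
Lemma riesz (f : H -> R[i]) (M : R) : {morph f : x y / x + y} ->
  (forall a x, f (a *: x) = a * f x) ->
  (forall x, rnorm (f x) <= M * rnorm x) -> exists z, forall x, f x = '[x, z].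
Proof.
move=> fD fZ fM'.
wlog M0 : M fM' / 0 <= M.
  move=> /(_ (Num.max M 0)); apply; last by rewrite le_max lexx orbT.
  by move=> x; rewrite (le_trans (fM' x))// ler_wpM2r ?rnorm_ge0// le_max lexx.
rename fM' into fM.
(* The minimization only involves the real part of [f]; the imaginary part is recovered at the end
   by evaluating at ['i *: x]. *)
pose g x := complex.Re (f x).
have gD x y : g (x + y) = g x + g y by rewrite /g fD raddfD.
have gZ (t : R) x : g (t%:C *: x) = t * g x.
  by rewrite /g fZ; case: (f x) => a b /=; rewrite mul0r subr0.
have gM x : `|g x| <= M * rnorm x by rewrite (le_trans (Re_le_rnorm _)).
pose J x := rnorm x ^+ 2 - 2 * g x.
have JD x y : J (x + y) = J x + J y + 2 * complex.Re '[x, y].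
  by rewrite /J rnorm_sqrD gD; ring.
pose S := range J.
have S0 : S !=set0 by exists (J 0); exists 0.
have Slb : has_lbound S.
  (* [|x|^2 - 2 M |x| = (|x| - M)^2 - M^2]. *)
  exists (- M ^+ 2) => _ [x _ <-]; rewrite /J lerBrDl.
  have := le_trans (ler_norm _) (gM x).
  have := sqr_ge0 (rnorm x - M).
  by rewrite sqrrB; lra.
pose d := inf S.
have dJ x : d <= J x by apply: ge_inf => //; exists x.
have /choice[u Ju] k : exists x, J x < d + (k.+1%:R)^-1.
  have [||_ [x _ <-] Jx] := @inf_adherent _ S (k.+1%:R)^-1; first by rewrite invr_gt0.
    by split.
  by exists x.
have JZ (t : R) x : J (t%:C *: x) = t ^+ 2 * rnorm x ^+ 2 - 2 * t * g x.
  by rewrite /J gZ rnormZ rnormC exprMn real_normK ?num_real//; ring.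
have small (e : R) : 0 < e -> exists N, forall k, (N <= k)%N -> (k.+1%:R)^-1 <= e.
  move=> e0; have [N hN] := near_infty_natSinv_lt (PosNum e0).
  by move=> HN; exists N => k Nk; rewrite ltW// HN.
(* [|u_m - u_k|^2 = 2 J u_m + 2 J u_k - 4 J ((u_m + u_k) / 2)], and the last value of [J] is at
   least [d]. *)
have diff m k : rnorm (u m - u k) ^+ 2 <= 2 * ((m.+1%:R)^-1 + (k.+1%:R)^-1).
  have := dJ (2^-1%:C *: (u m + u k)); have := Ju m; have := Ju k.
  rewrite JZ gD !rnorm_sqrD rnormN /J dotNr raddfN/=.
  set a := _.+1%:R^-1; set b := _.+1%:R^-1; rewrite mulfV ?pnatr_eq0//.
  have -> : (2^-1 ^+ 2 : R) = 1 / 4 by field.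
  by lra.
have [l ul] : exists l, forall e : R, 0 < e -> exists N, forall k, (N <= k)%N ->
    rnorm (u k - l) <= e.
  apply: rnorm_cauchy_cvg => e e0.
  have /small[N HN] : 0 < e ^+ 2 / 4 by rewrite divr_gt0 ?exprn_gt0.
  exists N => m k /HN hm /HN hk.
  rewrite -(@ler_pXn2r _ 2) ?nnegrE ?rnorm_ge0 ?(ltW e0)//.
  rewrite (le_trans (diff m k))//; move: hm hk.
  by set a := m.+1%:R^-1; set b := k.+1%:R^-1; lra.
have Jl : J l <= d.
  (* With [l = u k + w] and [|w| <= e <= 1], the excess of [J l] over [d] is at most [e] from
     [J (u k)], [e + 2 M e] from [J w] and [2 (|l| + 1) e] from the cross term, in total [e * K]. *)
  pose K := 4 + 2 * rnorm l + 2 * M.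
  have K0 : 0 < K by have := rnorm_ge0 _ l; rewrite /K; lra.
  apply/ler_addgt0Pr => e0 e0_gt0.
  pose e := Num.min 1 (e0 / K).
  have e_gt0 : 0 < e by rewrite lt_min ltr01 divr_gt0.
  have e1 : e <= 1 by rewrite ge_min lexx.
  have eK : e * K <= e0 by rewrite -ler_pdivlMr// ge_min lexx orbT.
  have [N1 HN1] := ul _ e_gt0; have [N2 HN2] := small _ e_gt0.
  pose k := maxn N1 N2.
  have hw := HN1 k (leq_maxl _ _); have hk := HN2 k (leq_maxr _ _).
  pose w := l - u k.
  have {}hw : rnorm w <= e by rewrite /w rnorm_distC.
  have -> : l = u k + w by rewrite /w addrC subrK.
  have uk : rnorm (u k) <= rnorm l + 1.
    have -> : u k = l + - w by rewrite /w opprB addrC subrK.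
    by rewrite (le_trans (rnormD _ _ _))// rnormN lerD2l (le_trans hw).
  rewrite JD.
  have d1 : complex.Re '[u k, w] <= (rnorm l + 1) * e.
    rewrite (le_trans (ler_norm _))// (le_trans (Re_le_rnorm _))//.
    by rewrite (le_trans (CauchySchwarz_rnorm _ _))// ler_pM ?rnorm_ge0.
  have d2 : J w <= e + 2 * (M * e).
    rewrite /J; have := gM w; rewrite ler_norml => /andP[gw _].
    have := ler_wpM2l M0 hw.
    have : rnorm w ^+ 2 <= e.
      by rewrite expr2 (le_trans (ler_pM _ _ hw hw)) ?rnorm_ge0// ler_piMl// ltW.
    by lra.
  by have := Ju k; move: eK hk d1 d2; rewrite /K; set b := k.+1%:R^-1; lra.
(* First variation at the minimizer: [J (l + t x) - J l] is a nonnegative quadratic polynomial in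
   [t], so its linear coefficient vanishes. *)
have crit x : complex.Re '[x, l] = g x.
  pose b := complex.Re '[x, l] - g x.
  have Jt (t : R) : 0 <= t ^+ 2 * rnorm x ^+ 2 + 2 * t * b.
    have := dJ (l + t%:C *: x); rewrite JD JZ dotZr conjc_real dotC.
    have -> : complex.Re (t%:C * '[x, l]^*%C) = t * complex.Re '[x, l].
      by case: '[x, l] => a c /=; rewrite mul0r subr0.
    by rewrite /b; lra.
  apply/subr0_eq; rewrite -/b.
  (* The summand 1 keeps [c] positive for [x = 0]; at [t = - b / c] the polynomial is negative
     unless [b = 0]. *)
  pose c := rnorm x ^+ 2 + 1.
  have c0 : 0 < c by rewrite /c ltr_wpDl ?sqr_ge0.
  have := Jt (- b / c).
  have -> : (- b / c) ^+ 2 * rnorm x ^+ 2 + 2 * (- b / c) * b =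
            - (b ^+ 2 * (rnorm x ^+ 2 + 2) / c ^+ 2).
    by rewrite /c; field; rewrite -/c gt_eqF.
  rewrite oppr_ge0 pmulr_lle0 ?invr_gt0 ?exprn_gt0// pmulr_lle0.
    by move=> b2; apply/eqP; rewrite -sqrf_eq0 eq_le b2 sqr_ge0.
  by rewrite ltr_wpDl ?sqr_ge0.
exists l => x; apply/eqP; rewrite eq_complex; apply/andP; split; apply/eqP.
  by rewrite crit.
have := crit ('i *: x); rewrite /g dotZl fZ.
case: '[x, l] => a b; case: (f x) => a' b' /=.
by rewrite !mul0r !mul1r !sub0r => /oppr_inj.
Qed.

(** Riesz represents [x |-> <A x, y>] by some [B y]; nondegeneracy makes [B] linear, and
    [|B y|^2 = <A (B y), y> <= M |B y| |y|] bounds it. *)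
Lemma adjointP {A} : bounded_op A -> bounded_op (adjoint dot A) /\
  forall x y, '[A x, y] = '[x, adjoint dot A y].
Proof.
move=> hA; apply: (@xgetPex _ _ [set B : H -> H | bounded_op B /\
  forall x y, '[A x, y] = '[x, B y]]).
have [M M0 AM] := bop_bound hA.
have /choice[B AB] y : exists z, forall x, '[A x, y] = '[x, z].
  apply: (@riesz _ (M * rnorm y)) => [x x'|a x|x].
  - by rewrite (bopD hA) dotDl.
  - by rewrite (bopZ hA) dotZl.
  - rewrite (le_trans (CauchySchwarz_rnorm _ _))// mulrAC.
    by rewrite ler_wpM2r ?rnorm_ge0.
exists B; split=> //; apply: (@bopI _ _ _ M) => [x y|a x|x].
- by apply: dot_inj => z; rewrite dotDr -!AB dotDr.
- by apply: dot_inj => z; rewrite dotZr -!AB dotZr.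
- have [->|B0] := eqVneq (rnorm (B x)) 0; first by rewrite mulr_ge0 ?rnorm_ge0 ?ltW.
  have {}B0 : 0 < rnorm (B x) by rewrite lt_neqAle eq_sym B0 rnorm_ge0.
  rewrite -(ler_pM2r B0) -expr2 -lecR -dotxx -AB.
  have -> : '[A (B x), x] = (rnorm '[A (B x), x])%:C.
    by rewrite -rnormE AB dotxx ger0_norm// ler0c sqr_ge0.
  rewrite lecR (le_trans (CauchySchwarz_rnorm _ _))//.
  by rewrite mulrAC ler_wpM2r ?rnorm_ge0.
Qed.

End InnerProduct.

(** * Cauchy-Schwarz for finite real sums *)

Section FiniteSums.
Context {R : realType}.

(** The nonnegative sum of the [(B a_i - C b_i)^2] equals [B (A B - C^2)], which settles [B > 0]; if
    [B = 0], every [b_i] vanishes. *)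
Lemma CauchySchwarz_sum (I : finType) (a b : I -> R) :
  (\sum_i a i * b i) ^+ 2 <= (\sum_i a i ^+ 2) * (\sum_i b i ^+ 2).
Proof.
pose A := \sum_i a i ^+ 2; pose B := \sum_i b i ^+ 2; pose C := \sum_i a i * b i.
have B0 : 0 <= B by apply: sumr_ge0 => i _; exact: sqr_ge0.
have : 0 <= \sum_i (B * a i - C * b i) ^+ 2.
  by apply: sumr_ge0 => i _; exact: sqr_ge0.
have -> : \sum_i (B * a i - C * b i) ^+ 2 = B * (A * B - C ^+ 2).
  rewrite (eq_bigr (fun i => B ^+ 2 * a i ^+ 2 - 2 * B * C * (a i * b i)
    + C ^+ 2 * b i ^+ 2)) => [|i _]; last by ring.
  rewrite !big_split/= sumrN -!mulr_sumr -/A -/B -/C; ring.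
rewrite -/A -/B -/C; have [B_gt0|B_le0] := ltP 0 B.
  by rewrite pmulr_rge0// subr_ge0.
have {}B0 : B = 0 by apply/eqP; rewrite eq_le B_le0.
have b0 i : b i = 0.
  apply/eqP; rewrite -sqrf_eq0; apply/eqP.
  by move/psumr_eq0P : B0 => ->// j _; exact: sqr_ge0.
by rewrite /C (eq_bigr (fun=> 0)) ?big1_eq ?expr0n ?B0 ?mulr0// => i _;
  rewrite b0 mulr0.
Qed.

End FiniteSums.

(** * Rows of operators and their Gram operator *)

Section RowOperators.
Context {R : realType} {H : completeNormedModType R[i]}.
Variable dot : {dot H for Num.conj}.
Hypothesis dot_norm : forall x : H, dot x x = `|x| ^+ 2.
Variables (I : finType) (A : I -> H -> H).
Hypothesis A_bounded : forall i, bounded_op (A i).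

Local Notation "A ^**" := (adjoint dot A) (at level 2, format "A ^**").
Local Notation gram := (fun x => \sum_i A i ((A i)^** x)).

Lemma bounded_adjoint i : bounded_op (A i)^**.
Proof. by have [] := adjointP dot_norm (A_bounded i). Qed.

Lemma dot_adjoint i x y : dot (A i x) y = dot x ((A i)^** y).
Proof. by have [_ ->] := adjointP dot_norm (A_bounded i). Qed.

Lemma bounded_gram : bounded_op gram.
Proof.
apply: (@bounded_op_sum _ _ _ _ _ (fun i => A i \o (A i)^**)) => i.
by apply: bounded_op_comp => //; exact: bounded_adjoint.
Qed.

Lemma dot_gram x : dot (gram x) x = (\sum_i rnorm ((A i)^** x) ^+ 2)%:C.
Proof.
rewrite dot_suml rmorph_sum/=; apply: eq_bigr => i _.
by rewrite dot_adjoint (dotxx dot_norm).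
Qed.

Lemma sum_adjoint_le x (c : R) : (forall y, rnorm (gram y) <= c * rnorm y) ->
  \sum_i rnorm ((A i)^** x) ^+ 2 <= c * rnorm x ^+ 2.
Proof.
move=> gc; rewrite -[leLHS]ger0_norm ?sumr_ge0// => [|i _]; last exact: sqr_ge0.
rewrite -rnormC -dot_gram (le_trans (CauchySchwarz_rnorm dot_norm _ _))//.
by rewrite expr2 mulrA ler_wpM2r ?rnorm_ge0.
Qed.

(** For [y] the row applied to [x], [|y|^2] is the sum of the pairings of [x_i] with the adjoint of
    [A_i] at [y]. Cauchy-Schwarz and [sum_adjoint_le] bound [|y|^4], and one factor [|y|^2]
    cancels. *)
Lemma row_le (x : I -> H) : rnorm (\sum_i A i (x i)) ^+ 2 <=
  opnorm gram * \sum_i rnorm (x i) ^+ 2.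
Proof.
set y := \sum_i _; have [->|y0] := eqVneq (rnorm y) 0.
  rewrite expr0n/= mulr_ge0 ?opnorm_ge0 ?sumr_ge0//.
    exact: bounded_gram.
  by move=> i _; exact: sqr_ge0.
have {}y0 : 0 < rnorm y ^+ 2 by rewrite exprn_gt0// lt_neqAle eq_sym y0 rnorm_ge0.
rewrite -(ler_pM2r y0) -expr2.
have yxA : rnorm y ^+ 2 <= \sum_i rnorm (x i) * rnorm ((A i)^** y).
  rewrite -(@rnormC_ge0 _ (rnorm y ^+ 2)) ?sqr_ge0//.
  rewrite -(dotxx dot_norm) {1}/y dot_suml.
  rewrite (le_trans (rnorm_sum _ _ _ _ _))//; apply: ler_sum => i _.
  by rewrite dot_adjoint CauchySchwarz_rnorm.
apply: le_trans (_ : _ <= (\sum_i rnorm (x i) * rnorm ((A i)^** y)) ^+ 2) _.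
  by rewrite ler_pXn2r ?nnegrE ?(ltW y0) ?(le_trans (ltW y0) yxA).
rewrite (le_trans (CauchySchwarz_sum _ _ _))// mulrAC mulrC ler_wpM2r//.
  by apply: sumr_ge0 => i _; exact: sqr_ge0.
by apply: sum_adjoint_le => z; exact: le_opnorm bounded_gram.
Qed.

(** Testing with [x_i] the adjoint of [A_i] at [y] gives [|gram y|^2 <= c <gram y, y> <= c |gram y|
    |y|]. *)
Lemma row_lub (c : R) : 0 <= c ->
  (forall x : I -> H, rnorm (\sum_i A i (x i)) ^+ 2 <=
     c * \sum_i rnorm (x i) ^+ 2) ->
  opnorm gram <= c.
Proof.
move=> c0 Ac; apply: opnorm_le => // y.
have [->|g0] := eqVneq (rnorm (gram y)) 0; first by rewrite mulr_ge0 ?rnorm_ge0.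
have {}g0 : 0 < rnorm (gram y) by rewrite lt_neqAle eq_sym g0 rnorm_ge0.
rewrite -(ler_pM2r g0) -expr2 (le_trans (Ac _))// -mulrA ler_wpM2l//.
rewrite -[leLHS]ger0_norm ?sumr_ge0// => [|i _]; last exact: sqr_ge0.
rewrite -rnormC -dot_gram mulrC.
exact: CauchySchwarz_rnorm.
Qed.

(* With t small, 1 - t A A^* is a contraction. *)
Lemma row_right_inverse (c : R) : 0 < c ->
  (forall x, c * rnorm x ^+ 2 <= \sum_i rnorm ((A i)^** x) ^+ 2) ->
  exists X : I -> H -> H, (forall i, bounded_op (X i)) /\
    forall x, \sum_i A i (X i x) = x.
Proof.
move=> c0 Ac; have [M0 M0_gt0 gM0] := bop_bound bounded_gram.
(* Enlarging the bound by [c] ensures [c <= M], hence [0 <= q2]. *)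
pose M := M0 + c.
have M_gt0 : 0 < M by rewrite addr_gt0.
have gM x : rnorm (gram x) <= M * rnorm x.
  by rewrite (le_trans (gM0 x))// ler_wpM2r ?rnorm_ge0// lerDl ltW.
(* This [t] minimizes [1 - 2 t c + t^2 M^2], which bounds [|D x|^2 / |x|^2]; the minimum is [q2]. *)
pose t := c / M ^+ 2.
have t0 : 0 < t by rewrite divr_gt0// exprn_gt0.
pose q2 := 1 - c ^+ 2 / M ^+ 2.
have cM : c ^+ 2 <= M ^+ 2.
  by rewrite ler_pXn2r ?nnegrE ?(ltW c0) ?(ltW M_gt0)// lerDr ltW.
have q2_ge0 : 0 <= q2 by rewrite subr_ge0 ler_pdivrMr ?exprn_gt0// mul1r.
have q2_lt1 : q2 < 1 by rewrite ltrBlDr ltrDl divr_gt0// exprn_gt0.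
pose D x := x - t%:C *: gram x.
have D_bounded : bounded_op D.
  apply: bounded_op_sub; first exact: bounded_op_id.
  exact: bounded_op_scale bounded_gram.
have [||X X_bounded XE] := neumann D (Num.sqrt q2) D_bounded.
- by rewrite -sqrtr1 ltr_sqrt.
- move=> x; rewrite -(@ler_pXn2r _ 2) ?nnegrE ?mulr_ge0 ?sqrtr_ge0 ?rnorm_ge0//.
  rewrite exprMn sqr_sqrtr// /D (rnorm_sqrD dot_norm) rnormN rnormZ.
  rewrite rnormC_ge0 ?(ltW t0)// dotNr dotZr conjc_real dotC dot_gram.
  rewrite conjc_real -rmorphM raddfN/=.
  have : (t * rnorm (gram x)) ^+ 2 <= c ^+ 2 / M ^+ 2 * rnorm x ^+ 2.
    have -> : c ^+ 2 / M ^+ 2 * rnorm x ^+ 2 = t ^+ 2 * (M * rnorm x) ^+ 2.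
      by rewrite /t; field; rewrite gt_eqF.
    rewrite exprMn ler_wpM2l ?sqr_ge0// ler_pXn2r// nnegrE ?rnorm_ge0//.
    by rewrite mulr_ge0 ?rnorm_ge0 ?ltW.
  have : c ^+ 2 / M ^+ 2 * rnorm x ^+ 2 <= t * \sum_i rnorm ((A i)^** x) ^+ 2.
    have -> : c ^+ 2 / M ^+ 2 * rnorm x ^+ 2 = t * (c * rnorm x ^+ 2).
      by rewrite /t; field; rewrite gt_eqF.
    by rewrite ler_wpM2l// ltW.
  by rewrite /q2; lra.
exists (fun i => (A i)^** \o (fun x => t%:C *: X x)); split=> [i|x].
  apply: bounded_op_comp; first exact: bounded_adjoint.
  exact: bounded_op_scale.
rewrite -[RHS]XE /D opprB addrC subrK -(bopZ bounded_gram).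
by [].
Qed.

End RowOperators.

(** * Right ideals generated by finitely many operators *)

Section RightIdeals.
Context {R : realType} {H : completeNormedModType R[i]}.
Implicit Types (S J : set (H -> H)).

Lemma right_ideal_bounded : right_ideal (@bounded_op R H).
Proof.
split=> //; first exact: bounded_op0.
- exact: bounded_op_add.
- exact: bounded_op_comp.
Qed.

(** The hypothesis on [S] makes [bounded_op] one of the ideals being intersected, so the
    intersection consists of bounded operators. *)
Lemma right_ideal_gen_ideal S : S `<=` @bounded_op R H ->
  right_ideal (right_ideal_gen S).
Proof.
move=> SB; split.
- by move=> A /(_ _ (conj right_ideal_bounded SB)).
- by move=> J [[]].
- by move=> A B SA SB' J JS; have [_ _ JD _] := JS.1; apply: JD;
    [exact: SA|exact: SB'].
- by move=> A X SA hX J JS; have [_ _ _ JM] := JS.1; apply: JM => //; exact: SA.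
Qed.

Lemma right_ideal_sum J (I : Type) (r : seq I) (F : I -> H -> H) :
  right_ideal J -> (forall i, J (F i)) -> J (fun x => \sum_(i <- r) F i x).
Proof.
move=> [_ J0 JD _] JF; elim: r => [|i r IH].
  by under eq_fun do rewrite big_nil.
by under eq_fun do rewrite big_cons; exact: JD.
Qed.

(** The operators [\sum_i A_i X_i] form a right ideal that contains every [A_i] and is contained in
    each right ideal that does. *)
Lemma right_ideal_gen_idP (I : finType) (A : I -> H -> H) :
  (forall i, bounded_op (A i)) ->
  right_ideal_gen (range A) id <->
  exists X : I -> H -> H, (forall i, bounded_op (X i)) /\
    forall x, \sum_i A i (X i x) = x.
Proof.
move=> hA; have AB : range A `<=` @bounded_op R H by move=> _ [i _ <-].
split=> [|[X [hX AX]]].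
  pose J := [set B : H -> H | exists X : I -> H -> H,
    (forall i, bounded_op (X i)) /\ B = fun x => \sum_i A i (X i x)].
  have JA : range A `<=` J.
    move=> _ [i _ <-]; exists (fun j => if j == i then id else fun=> 0).
    split=> [j|]; first by case: ifP => _; [exact: bounded_op_id|exact: bounded_op0].
    apply/funext => x; rewrite (bigD1 i)//= eqxx big1 ?addr0// => j /negPf ->.
    exact: bop0.
  have Jideal : right_ideal J.
    split.
    - move=> _ [X [hX ->]].
      apply: (@bounded_op_sum _ _ _ _ _ (fun i => A i \o X i)) => i.
      exact: bounded_op_comp.
    - exists (fun _ _ => 0); split=> [i|]; first exact: bounded_op0.
      by apply/funext => x; rewrite big1// => i _; exact: bop0.
    - move=> _ _ [X [hX ->]] [Y [hY ->]]; exists (fun i => X i \+ Y i).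
      split=> [i|]; first exact: bounded_op_add.
      apply/funext => x /=; rewrite -big_split/=; apply: eq_bigr => i _.
      by rewrite (bopD (hA i)).
    - move=> _ Y [X [hX ->]] hY; exists (fun i => X i \o Y); split=> // i.
      exact: bounded_op_comp.
  move=> /(_ _ (conj Jideal JA))[X [hX idX]]; exists X; split=> // x.
  by have /(congr1 (fun f => f x)) := idX.
have Jideal := right_ideal_gen_ideal _ AB.
have -> : id = fun x : H => \sum_i A i (X i x) by apply/funext => x; rewrite AX.
apply: (@right_ideal_sum _ _ _ (fun i => A i \o X i)) => // i.
have [_ _ _ JM] := Jideal; apply: JM => // J [_]; apply.
by exists i.
Qed.

End RightIdeals.

(** * Topology of [C^n]: neighbourhoods, closed balls, compactness *)

Section RowVectorTopology.
Context {R : realType} {n : nat}.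

Lemma nbhs_rV (l : 'rV[R[i]^o]_n) (B : set 'rV[R[i]^o]_n) :
  nbhs l B <-> exists2 e : R, 0 < e &
    forall v : 'rV[R[i]^o]_n,
      (forall i, rnorm (l 0 i - v 0 i : R[i]) < e) -> B v.
Proof.
split=> [/nbhs_ballP[[a b]]|[e e0 eB]].
  rewrite /= ltcE/= => /andP[/eqP-> a0] lB; exists a => // v lv.
  apply: lB; split=> [|i j]; first by rewrite ltcR.
  rewrite ord1 -ball_normE/= rnormE ltcR.
  exact: lv.
apply/nbhs_ballP; exists e%:C; first by rewrite /= ltcR.
move=> v [_ lv]; apply: eB => i; have := lv 0 i.
by rewrite -ball_normE/= rnormE ltcR.
Qed.

Lemma closed_ball_coord (s : R) (l : 'rV[R[i]^o]_n) i : 0 <= s ->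
  closed_ball_Cn s l -> rnorm (l 0 i) <= s.
Proof.
move=> s0 ls; rewrite -(@ler_pXn2r _ 2) ?nnegrE ?rnorm_ge0// (le_trans _ ls)//.
by rewrite (bigD1 i)//= lerDl sumr_ge0// => j _; exact: sqr_ge0.
Qed.

Lemma closure_closed_ball (s : R) : 0 <= s ->
  closure (@closed_ball_Cn R n s) `<=` closed_ball_Cn s.
Proof.
move=> s0 l ls; rewrite /closed_ball_Cn/=; apply/ler_addgt0Pr => e0 e0_gt0.
(* A change of at most [e <= 1] in a coordinate of modulus at most [s] raises its square by at most
   [e (2 s + 1)]; the last 1 keeps [K] positive. *)
pose K := n%:R * (2 * s + 1) + 1.
have K0 : 0 < K by rewrite ltr_wpDl// mulr_ge0// addr_ge0// mulr_ge0.
pose e := Num.min 1 (e0 / K).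
have e_gt0 : 0 < e by rewrite lt_min ltr01 divr_gt0.
have e1 : e <= 1 by rewrite ge_min lexx.
have eK : e * K <= e0 by rewrite -ler_pdivlMr// ge_min lexx orbT.
have /ls[v [/= vs lv]] :
    nbhs l [set v : 'rV[R[i]^o]_n | forall i, rnorm (l 0 i - v 0 i : R[i]) < e].
  by apply/nbhs_rV; exists e.
have vis i : rnorm (v 0 i) <= s by exact: closed_ball_coord.
have li i : rnorm (l 0 i) ^+ 2 <= rnorm (v 0 i) ^+ 2 + e * (2 * s + 1).
  have h : rnorm (l 0 i) <= rnorm (v 0 i) + e.
    rewrite -{1}(subrK (v 0 i) (l 0 i)) (le_trans (rnormD _ _ _))// addrC lerD2l.
    exact/ltW/lv.
  apply: (le_trans (_ : _ <= (rnorm (v 0 i) + e) ^+ 2)).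
    by rewrite ler_pXn2r ?nnegrE ?addr_ge0 ?rnorm_ge0// ltW.
  have := vis i; have := rnorm_ge0 _ (v 0 i); nra.
apply: (le_trans (ler_sum _ (fun i _ => li i))).
rewrite big_split/= sumr_const card_ord -mulr_natl lerD// (le_trans _ eK)//.
by rewrite /K; nra.
Qed.

Lemma closed_ball_subset (s t : R) : 0 <= s -> s <= t ->
  @closed_ball_Cn R n s `<=` closed_ball_Cn t.
Proof.
move=> s0 st l /= /le_trans; apply.
by rewrite ler_pXn2r ?nnegrE// (le_trans s0).
Qed.

(** The ball lies in a product of compact squares, each the image of a real square under
    [(a, b) |-> a + i b]. *)
Lemma closed_subball_compact (A : set 'rV[R[i]^o]_n) (s : R) : 0 <= s ->
  closed A -> A `<=` closed_ball_Cn s -> compact A.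
Proof.
move=> s0 clA As.
pose c (p : R * R) : R[i]^o := p.1 +i* p.2.
have c_cont : continuous c.
  move=> [a b]; apply/cvgrPdist_lt => -[r r']; rewrite ltcE/= => /andP[/eqP-> r0].
  have r2 : 0 < r / 2 by rewrite divr_gt0.
  exists (ball a (r / 2), ball b (r / 2)); first by split; exact: nbhsx_ballx.
  move=> [a' b'] /= []; rewrite -!ball_normE/= => ha hb.
  rewrite rnormE ltcR.
  have -> : c (a, b) - c (a', b') = (a - a')%:C + 'i%C * (b - b')%:C.
    rewrite /c/=; apply/eqP; rewrite eq_complex/=.
    by apply/andP; split; apply/eqP; ring.
  rewrite (le_lt_trans (rnormD _ _ _))// rnormM !rnormC.
  by rewrite rnorm_i mul1r (splitr r) ltrD.
pose K := c @` (`[- s, s] `*` `[- s, s])%classic.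
have Kc : compact K.
  apply: continuous_compact; first exact: continuous_subspaceT.
  by apply: compact_setX; exact: segment_compact.
apply: subclosed_compact clA (rV_compact (fun=> Kc)) _ => l /As ls i.
have lis : rnorm (l 0 i) <= s by exact: closed_ball_coord.
have ReIm (z : R[i]) : rnorm z <= s ->
    (`[- s, s] `*` `[- s, s])%classic (complex.Re z, complex.Im z).
  move=> zs; split=> /=; rewrite in_itv/= -ler_norml (le_trans _ zs)//.
    exact: Re_le_rnorm.
  rewrite -normrN -ReiNIm (le_trans (Re_le_rnorm _))// rnormM.
  by rewrite rnorm_i mulr1.
exists (complex.Re (l 0 i), complex.Im (l 0 i)); first exact: ReIm.
by rewrite /c/=; case: (l 0 i).
Qed.

End RowVectorTopology.

(** * The right spectrum through right inverses, and its closedness *)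

Section RightSpectrum.
Context {R : realType} {H : completeNormedModType R[i]} {n : nat}.
Variable T : 'I_n -> H -> H.
Hypothesis T_bounded : forall i, bounded_op (T i).

Lemma bounded_resolvent (l : 'rV[R[i]^o]_n) i :
  bounded_op (fun x => l 0 i *: x - T i x).
Proof.
by apply: bounded_op_sub => //; apply: bounded_op_scale; exact: bounded_op_id.
Qed.

Lemma right_spectrumPn (l : 'rV[R[i]^o]_n) :
  ~ right_spectrum T l <->
  exists X : 'I_n -> H -> H, (forall i, bounded_op (X i)) /\
    forall x, \sum_i (l 0 i *: X i x - T i (X i x)) = x.
Proof.
rewrite /right_spectrum/= notK.
exact: (right_ideal_gen_idP _ _ (bounded_resolvent l)).
Qed.

Lemma right_spectrum_closed : closed (right_spectrum T).
Proof.
rewrite -[right_spectrum T]setCK; apply: open_closedC; rewrite openE => l.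
move=> /right_spectrumPn[X [hX XE]].
pose N i := xget 0 [set M : R | 0 < M /\ forall x, rnorm (X i x) <= M * rnorm x].
have NP i : 0 < N i /\ forall x, rnorm (X i x) <= N i * rnorm x.
  have [M M0 XM] := bop_bound (hX i).
  by rewrite /N; apply: (@xgetPex _ _ [set M : R | 0 < M /\
    forall x, rnorm (X i x) <= M * rnorm x]); exists M.
(* Moving each coordinate by less than [1 / (2 M)] keeps [D] below of norm at most [1 / 2]. *)
pose M := \sum_i N i + 1.
have M0 : 0 < M by rewrite ltr_wpDl// sumr_ge0// => i _; apply/ltW/(NP i).1.
apply/nbhs_rV; exists (2 * M)^-1; first by rewrite invr_gt0 mulr_gt0.
move=> v lv; apply/right_spectrumPn.
(* [\sum_i (v_i - T_i) X_i = 1 - D], so a right inverse [Y] of [1 - D] yields the solution [X_i Y]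
   at [v]. *)
pose D x := \sum_i (l 0 i - v 0 i) *: X i x.
have hD : bounded_op D.
  apply: (@bounded_op_sum _ _ _ _ _ (fun i x => (l 0 i - v 0 i) *: X i x)) => i.
  exact: bounded_op_scale.
have [||Y hY YE] := neumann D (2^-1) hD.
- by rewrite invf_lt1// ltr1n.
- move=> x; rewrite /D (le_trans (rnorm_sum _ _ _ _ _))//.
  apply: (@le_trans _ _ (\sum_i (2 * M)^-1 * (N i * rnorm x))).
    apply: ler_sum => i _; rewrite rnormZ ler_pM ?rnorm_ge0//.
      exact/ltW/lv.
    by have [_] := NP i.
  rewrite -mulr_sumr -mulr_suml mulrA ler_wpM2r ?rnorm_ge0// invfM -mulrA.
  by rewrite ler_piMr// ler_pdivrMl// mulr1 /M lerDl.
exists (fun i => X i \o Y); split=> [i|x]; first exact: bounded_op_comp.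
rewrite -[RHS]YE -{1}(XE (Y x)) /D -sumrB; apply: eq_bigr => i _ /=.
by rewrite scalerBl opprB addrCA addrAC subrr sub0r addrC.
Qed.

End RightSpectrum.

(** * Sums over words of fixed length *)

Section Words.
Context {V : nmodType} {n : nat}.
Implicit Type f : seq 'I_n -> V.

Lemma sum_tuple0 f : \sum_(w : 0.-tuple 'I_n) f w = f [::].
Proof.
by rewrite (big_pred1 [tuple])// => w; apply/esym/eqP; exact: tuple0.
Qed.

Lemma sum_tupleS k f : \sum_(w : k.+1.-tuple 'I_n) f w =
  \sum_(i < n) \sum_(w : k.-tuple 'I_n) f (i :: w).
Proof.
rewrite pair_big/= (reindex (fun p : 'I_n * k.-tuple 'I_n => cons_tuple p.1 p.2)).
  by apply: eq_bigr => -[i w].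
exists (fun w => (thead w, behead_tuple w)) => [[i w] _|w _] /=.
  by congr pair; apply: val_inj.
by rewrite [RHS]tuple_eta; apply: val_inj.
Qed.

(** Taking [f] on all words rather than on tuples lets words be concatenated without casts. *)
Lemma sum_tuple_cat k l f : \sum_(w : (k + l).-tuple 'I_n) f w =
  \sum_(u : k.-tuple 'I_n) \sum_(v : l.-tuple 'I_n) f (u ++ v).
Proof.
elim: k f => [|k IH] f.
  by rewrite (sum_tuple0 (fun u => \sum_(v : l.-tuple 'I_n) f (u ++ v))).
rewrite [LHS](@sum_tupleS (k + l)).
rewrite (sum_tupleS k (fun u => \sum_(v : l.-tuple 'I_n) f (u ++ v))).
by apply: eq_bigr => i _; rewrite (IH (fun w => f (i :: w))).
Qed.

Lemma sum_tuple_rev k f : \sum_(w : k.-tuple 'I_n) f (rev w) =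
  \sum_(w : k.-tuple 'I_n) f w.
Proof.
rewrite [RHS](reindex (fun w : k.-tuple 'I_n => [tuple of rev w])) //.
by exists (fun w : k.-tuple 'I_n => [tuple of rev w]) => w _;
  apply: val_inj; rewrite /= revK.
Qed.

End Words.

Lemma sum_tuple_prod (R : comNzRingType) n k (c : 'I_n -> R) :
  \sum_(w : k.-tuple 'I_n) \prod_(i <- w) c i = (\sum_i c i) ^+ k.
Proof.
elim: k => [|k IH].
  by rewrite (sum_tuple0 (fun w => \prod_(i <- w) c i)) big_nil.
rewrite (sum_tupleS k (fun w => \prod_(i <- w) c i)) exprS mulr_suml.
apply: eq_bigr => i _; rewrite -IH mulr_sumr; apply: eq_bigr => w _.
by rewrite big_cons.
Qed.

(** * Convergence of the roots of a submultiplicative sequence *)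

Section SubmultiplicativeRoots.
Context {R : realType} (a u : nat -> R).
Hypothesis a_sub : forall k l, a (k + l)%N <= a k * a l.
Hypothesis a_ge0 : forall k, 0 <= a k.
Hypothesis u_ge0 : forall k, 0 <= u k.
Hypothesis uK : forall k, (0 < k)%N -> u k ^+ (2 * k) = a k.

(** Blocks of length [m] are peeled off, each costing [t ^+ (2 * m)]; the constant absorbs all
    remainders [j < m]. *)
Lemma submultiplicative_geometric m (t : R) : (0 < m)%N -> 0 < t ->
  a m <= t ^+ (2 * m) -> exists C, forall k, a k <= C * t ^+ (2 * k).
Proof.
move=> m0 t0 amt; exists (\sum_(j < m) a j / t ^+ (2 * j)) => k.
set C := \sum_(j < m) _.
elim/ltn_ind: k => k IH; have [km|mk] := ltnP k m.
  rewrite -ler_pdivrMr ?exprn_gt0// /C (bigD1 (Ordinal km))//= lerDl.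
  by apply: sumr_ge0 => j _; rewrite divr_ge0 ?exprn_ge0// ltW.
rewrite -(subnKC mk) (le_trans (a_sub _ _))// mulnDr exprD mulrCA.
rewrite ler_pM//; apply: IH; lia.
Qed.

(** [C (t / (t + e))^(2 k)] tends to 0, hence is eventually at most 1, which absorbs [C] before
    roots are taken. *)
Lemma geometric_near (C t e : R) : 0 < t -> 0 < e ->
  (forall k, a k <= C * t ^+ (2 * k)) -> \forall k \near \oo, u k <= t + e.
Proof.
move=> t0 e0 aC; have te : 0 < t + e by rewrite addr_gt0.
pose q := (t / (t + e)) ^+ 2.
have q0 : 0 <= q by rewrite sqr_ge0.
have q1 : q < 1.
  by rewrite /q exprn_ilt1 ?divr_ge0 ?ltW// ltr_pdivrMr// mul1r ltrDl.
have /cvgrPdist_le/(_ 1 ltr01) : (fun k => C * q ^+ k) @ \oo --> 0.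
  by apply: cvg_geometric; rewrite ger0_norm.
move=> [N _ HN]; exists N.+1 => // k /= Nk.
have k0 : (0 < k)%N by apply: leq_trans Nk.
rewrite -(@ler_pXn2r _ (2 * k)) ?muln_gt0 ?nnegrE ?u_ge0 ?(ltW te)//.
rewrite uK// (le_trans (aC k))//.
have := HN k (ltnW Nk); rewrite /= sub0r normrN => /(le_trans (ler_norm _)).
rewrite /q -exprM exprMn exprVn mulrA ler_pdivrMr ?exprn_gt0// mul1r.
by [].
Qed.

Lemma root_geometric m (t : R) : (0 < m)%N -> 0 < t -> u m <= t ->
  exists C, forall k, a k <= C * t ^+ (2 * k).
Proof.
move=> m0 t0 umt; apply: (@submultiplicative_geometric m) => //.
by rewrite -uK// ler_pXn2r ?nnegrE ?muln_gt0 ?(ltW t0).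
Qed.

(** Fekete's argument: the limit is the infimum over [k > 0], as one [m] with [u m] near the infimum
    yields a geometric bound on all of [a]. Index 0 is left out because [uK] does not constrain
    [u 0]. *)
Lemma submultiplicative_root_cvg : cvg (u @ \oo).
Proof.
pose S := [set u k | k in [set k | (0 < k)%N]].
have S_inf : has_inf S.
  split; first by exists (u 1); exists 1%N.
  by exists 0 => _ [k _ <-].
apply/cvg_ex; exists (inf S); apply/cvgrPdist_le => e e0.
have inf_ge0 : 0 <= inf S.
  by apply: lb_le_inf => [|_ [k _ <-]]; [exact: S_inf.1|].
have e2 : 0 < e / 2 by rewrite divr_gt0.
have [_ [m /= m0 <-] um] := inf_adherent e2 S_inf.
have t0 : 0 < inf S + e / 2 by rewrite ltr_wpDl.
have [C aC] := root_geometric m _ m0 t0 (ltW um).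
have [N _ HN] := geometric_near _ _ _ t0 e2 aC.
exists N.+1 => // k /= Nk; rewrite ler_norml; apply/andP; split.
  by have := HN k (ltnW Nk); rewrite /=; lra.
rewrite (@le_trans _ _ 0)//; last exact: ltW.
rewrite subr_le0; apply: ge_inf; first exact: S_inf.2.
by exists k => //=; apply: leq_trans Nk.
Qed.

Lemma lim_root_le (C t : R) : 0 < t -> (forall k, a k <= C * t ^+ (2 * k)) ->
  lim (u @ \oo) <= t.
Proof.
move=> t0 aC; apply/ler_addgt0Pr => e e0.
apply: limr_le; first exact: submultiplicative_root_cvg.
exact: geometric_near aC.
Qed.

Lemma lim_root_ge0 : 0 <= lim (u @ \oo).
Proof.
apply: limr_ge; first exact: submultiplicative_root_cvg.
by apply: nearW.
Qed.

Lemma lim_root_lt (t : R) : lim (u @ \oo) < t ->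
  exists2 k, (0 < k)%N & a k < t ^+ (2 * k).
Proof.
move=> ut; have [N _ HN] : \forall k \near \oo, u k < t.
  by apply: cvgr_lt ut; exact: submultiplicative_root_cvg.
exists N.+1 => //; have t0 : 0 <= t := le_trans lim_root_ge0 (ltW ut).
rewrite -uK// ltr_pXn2r ?nnegrE ?muln_gt0//.
exact: (HN N.+1 (leqnSn N)).
Qed.

End SubmultiplicativeRoots.

(** * Rows of word operators and the joint spectral radius *)

Section WordOperators.
Context {R : realType} {H : completeNormedModType R[i]}.
Variable dot : {dot H for Num.conj}.
Hypothesis dot_norm : forall x : H, dot x x = `|x| ^+ 2.
Context {n : nat}.
Variable T : 'I_n -> H -> H.
Hypothesis T_bounded : forall i, bounded_op (T i).

Lemma word_op_cat u v : word_op T (u ++ v) = word_op T u \o word_op T v.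
Proof. by elim: u => //= i u ->. Qed.

Lemma bounded_word_op w : bounded_op (word_op T w).
Proof.
elim: w => [|i w IH] /=; first exact: bounded_op_id.
exact: bounded_op_comp.
Qed.

(** The squared norm of the row of all word operators of length [k]. *)
Definition gram_norm k :=
  opnorm (fun x => \sum_(w : k.-tuple 'I_n)
                     word_op T w (adjoint dot (word_op T w) x)).

Lemma gram_norm_ge0 k : 0 <= gram_norm k.
Proof.
apply: opnorm_ge0.
apply: (bounded_gram _ dot_norm _ (fun w : k.-tuple _ => word_op T w)).
by move=> w; exact: bounded_word_op.
Qed.

Lemma gram_norm_row k (x : seq 'I_n -> H) :
  rnorm (\sum_(w : k.-tuple 'I_n) word_op T w (x w)) ^+ 2 <=
  gram_norm k * \sum_(w : k.-tuple 'I_n) rnorm (x w) ^+ 2.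
Proof.
apply: (row_le _ dot_norm _ (fun w : k.-tuple _ => word_op T w) _
  (fun w : k.-tuple 'I_n => x w)).
by move=> w; exact: bounded_word_op.
Qed.

Lemma gram_norm_le k (c : R) : 0 <= c ->
  (forall x : seq 'I_n -> H,
     rnorm (\sum_(w : k.-tuple 'I_n) word_op T w (x w)) ^+ 2 <=
     c * \sum_(w : k.-tuple 'I_n) rnorm (x w) ^+ 2) ->
  gram_norm k <= c.
Proof.
move=> c0 Tc; apply: (row_lub _ dot_norm _ (fun w : k.-tuple _ => word_op T w)) => //.
  by move=> w; exact: bounded_word_op.
(* A family indexed by tuples is extended by 0 to words of other lengths. *)
move=> x; pose y (w : seq 'I_n) := oapp x 0 (insub w).
have yx (w : k.-tuple 'I_n) : y w = x w by rewrite /y valK.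
have := Tc y; under eq_bigr do rewrite yx.
by under [X in c * X]eq_bigr do rewrite yx.
Qed.

(** A word of length [k + l] splits uniquely as [u ++ v]; the row bound of length [l] applies to the
    inner sums over [v], that of length [k] to the outer one. *)
Lemma gram_norm_submultiplicative k l :
  gram_norm (k + l) <= gram_norm k * gram_norm l.
Proof.
apply: gram_norm_le => [|x]; first by rewrite mulr_ge0 ?gram_norm_ge0.
rewrite (sum_tuple_cat k l (fun w => word_op T w (x w))).
rewrite (sum_tuple_cat k l (fun w => rnorm (x w) ^+ 2)).
pose y u := \sum_(v : l.-tuple 'I_n) word_op T v (x (u ++ v)).
rewrite (eq_bigr (fun u : k.-tuple 'I_n => word_op T u (y u))); last first.
  move=> u _; rewrite /y (bop_sum _ _ _ _ (bounded_word_op u)).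
  by apply: eq_bigr => v _; rewrite word_op_cat.
apply: (le_trans (gram_norm_row k y)).
rewrite -mulrA ler_wpM2l ?gram_norm_ge0// mulr_sumr; apply: ler_sum => u _.
exact: (gram_norm_row l (fun v => x (u ++ v))).
Qed.

Let root k := gram_norm k `^ ((2 * k)%N%:R^-1).

Let root_ge0 k : 0 <= root k. Proof. exact: powR_ge0. Qed.

Let rootK k : (0 < k)%N -> root k ^+ (2 * k) = gram_norm k.
Proof.
move=> k0; rewrite /root -powR_mulrn ?powR_ge0// -powRrM mulVf.
  by rewrite powRr1// gram_norm_ge0.
by rewrite pnatr_eq0 muln_eq0 -lt0n k0.
Qed.

Lemma spectral_radius_ge0 : 0 <= spectral_radius dot T.
Proof.
exact: (lim_root_ge0 _ root gram_norm_submultiplicative gram_norm_ge0 root_ge0 rootK).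
Qed.

Lemma spectral_radius_le (C t : R) : 0 < t ->
  (forall k, gram_norm k <= C * t ^+ (2 * k)) -> spectral_radius dot T <= t.
Proof.
exact: (lim_root_le _ root gram_norm_submultiplicative gram_norm_ge0 root_ge0 rootK).
Qed.

Lemma spectral_radius_lt (t : R) : spectral_radius dot T < t ->
  exists2 k, (0 < k)%N & gram_norm k < t ^+ (2 * k).
Proof.
exact: (lim_root_lt _ root gram_norm_submultiplicative gram_norm_ge0 root_ge0 rootK).
Qed.

(** Puts powers of a linear combination in row form, so that [gram_norm_row] bounds them. *)
Lemma iter_linear_combination (c : 'I_n -> R[i]) k x :
  iter k (fun y => \sum_i c i *: T i y) x =
  \sum_(w : k.-tuple 'I_n) word_op T w ((\prod_(i <- w) c i) *: x).
Proof.
elim: k => [|k IH].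
  rewrite (sum_tuple0 (fun w => word_op T w ((\prod_(i <- w) c i) *: x))).
  by rewrite /= big_nil scale1r.
rewrite iterS IH (sum_tupleS k (fun w => word_op T w ((\prod_(i <- w) c i) *: x))).
apply: eq_bigr => i _; rewrite (bop_sum _ _ _ _ (T_bounded i)) scaler_sumr.
apply: eq_bigr => w _ /=; rewrite -(bopZ (T_bounded i)).
by rewrite -(bopZ (bounded_word_op w)) scalerA big_cons.
Qed.

(* With C = (\sum_i conj (l i) T_i) / |l|^2, the operator 1 - C lies in the
   right ideal of l, hence so does 1 - C^k, which is right invertible as soon
   as |C^k| < 1. *)
Lemma right_spectrum_spectral_radius :
  right_spectrum T `<=` closed_ball_Cn (spectral_radius dot T).
Proof.
move=> l; apply: contraPP => lr; apply/right_spectrumPn => //.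
pose L2 := \sum_(i < n) rnorm (l 0 i) ^+ 2.
have rl : spectral_radius dot T ^+ 2 < L2 by rewrite ltNge; apply/negP.
have L2_gt0 : 0 < L2 by rewrite (le_lt_trans _ rl)// sqr_ge0.
have /spectral_radius_lt[k k0 gk] : spectral_radius dot T < Num.sqrt L2.
  by rewrite -(ger0_norm spectral_radius_ge0) -sqrtr_sqr ltr_sqrt.
rewrite exprM sqr_sqrtr ?(ltW L2_gt0)// in gk.
pose c i : R[i] := (l 0 i)^*%C * (L2^-1)%:C.
pose C y := \sum_i c i *: T i y.
have C_bounded : bounded_op C.
  apply: (@bounded_op_sum _ _ _ _ _ (fun i x => c i *: T i x)) => i.
  exact: bounded_op_scale.
have iter_bounded m : bounded_op (iter m C).
  elim: m => [|m IH]; first exact: bounded_op_id.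
  exact: (bounded_op_comp _ _ C_bounded IH).
pose Z x := \sum_(m < k) iter m C x.
have Z_bounded : bounded_op Z.
  exact: (@bounded_op_sum _ _ _ _ _ (fun m : 'I_k => iter m C)).
(* This normalization gives [1 - C = \sum_i (l_i - T_i) c_i]. *)
have cl : \sum_i l 0 i * c i = 1.
  rewrite (eq_bigr (fun i => (rnorm (l 0 i) ^+ 2)%:C * (L2^-1)%:C)).
    by rewrite -mulr_suml -rmorph_sum -rmorphM mulfV ?gt_eqF.
  by move=> i _; rewrite /c mulrA -sqr_rnorm.
have ZC x : Z x - C (Z x) = x - iter k C x.
  rewrite /Z (bop_sum _ _ _ _ C_bounded) -sumrB.
  rewrite -[X in X - _]/(iter 0 C x) -opprB -(telescope_sumr (fun m => iter m C x))//.
  by rewrite big_mkord -sumrN; apply: eq_bigr => m _; rewrite opprB.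
(* The squared moduli of the coefficients of [C^k] then sum to [L2^-k], so
   [|C^k x|^2 <= gram_norm k / L2^k * |x|^2]. *)
have c2 : \sum_i rnorm (c i) ^+ 2 = L2^-1.
  rewrite (eq_bigr (fun i => rnorm (l 0 i) ^+ 2 * L2^-1 ^+ 2)); last first.
    by move=> i _; rewrite rnormM rnormJ rnormC_ge0 ?invr_ge0 ?(ltW L2_gt0)// exprMn.
  by rewrite -mulr_suml -/L2; field; rewrite gt_eqF.
have gk1 : gram_norm k / L2 ^+ k < 1 by rewrite ltr_pdivrMr ?mul1r// exprn_gt0.
have [||Y Y_bounded YE] :=
  neumann (iter k C) (Num.sqrt (gram_norm k / L2 ^+ k)) (iter_bounded k).
- by rewrite -sqrtr1 ltr_sqrt.
- move=> x; rewrite -(@ler_pXn2r _ 2) ?nnegrE ?mulr_ge0 ?sqrtr_ge0 ?rnorm_ge0//.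
  rewrite exprMn sqr_sqrtr ?divr_ge0 ?gram_norm_ge0 ?exprn_ge0 ?(ltW L2_gt0)//.
  rewrite iter_linear_combination.
  apply: (le_trans (gram_norm_row k (fun w => (\prod_(i <- w) c i) *: x))).
  rewrite -mulrA ler_wpM2l ?gram_norm_ge0//.
  under eq_bigr do rewrite rnormZ exprMn.
  rewrite -mulr_suml ler_wpM2r ?sqr_ge0//.
  under eq_bigr do rewrite rnorm_prod -prodrXl.
  by rewrite (sum_tuple_prod _ _ _ (fun i => rnorm (c i) ^+ 2)) c2 exprVn.
(* [\sum_i (l_i - T_i) c_i Z Y = (1 - C) Z Y = (1 - C^k) Y = 1]. *)
exists (fun i x => c i *: Z (Y x)); split=> [i|x].
  by apply: bounded_op_scale; exact: bounded_op_comp.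
rewrite sumrB -[RHS]YE -ZC; congr (_ - _).
  by under eq_bigr do rewrite scalerA; rewrite -scaler_suml cl scale1r.
by apply: eq_bigr => i _; rewrite (bopZ (T_bounded i)).
Qed.

End WordOperators.

#[local] Existing Instance summability.totally_filter.

(** * Unordered sums of finitely supported families of words *)

Section WordsOfBoundedLength.
Context {n : nat}.

Fixpoint short_words K : seq (seq 'I_n) :=
  if K is K'.+1 then short_words K' ++ [seq tval w | w <- enum {: K'.-tuple 'I_n}]
  else [::].

Lemma mem_short_words K w : (w \in short_words K) = (size w < K)%N.
Proof.
elim: K => //= K IH; rewrite mem_cat IH ltnS [RHS]leq_eqVlt orbC; congr (_ || _).
apply/mapP/eqP => [[v _ ->]|wK]; first by rewrite size_tuple.
by exists (tcast wK (in_tuple w)); rewrite ?mem_enum// val_tcast.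
Qed.

Lemma short_words_uniq K : uniq (short_words K).
Proof.
elim: K => //= K IH; rewrite cat_uniq IH map_inj_uniq ?enum_uniq ?andbT//=.
  by apply/hasPn => _ /mapP[w _ ->]; rewrite mem_short_words size_tuple ltnn.
exact: val_inj.
Qed.

Lemma sum_short_words (V : nmodType) K (f : seq 'I_n -> V) :
  \sum_(w <- short_words K) f w = \sum_(k < K) \sum_(w : k.-tuple 'I_n) f w.
Proof.
elim: K => [|K IH]; first by rewrite big_nil big_ord0.
by rewrite /= big_cat/= IH big_ord_recr/= big_map big_enum.
Qed.

Context {R : realType}.

Lemma esum_short_words K (f : seq 'I_n -> R) : (forall w, 0 <= f w) ->
  (forall w, (K <= size w)%N -> f w = 0) ->
  (\esum_(w in [set: seq 'I_n]) (f w)%:E)%E =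
  (\sum_(k < K) \sum_(w : k.-tuple 'I_n) f w)%:E.
Proof.
move=> f0 fK; pose F := [set` short_words K].
have -> : (\esum_(w in [set: seq 'I_n]) (f w)%:E)%E = (\esum_(w in F) (f w)%:E)%E.
  rewrite [RHS]esum_mkcond; congr esum; apply/funext => w; case: ifPn => // wF.
  rewrite fK// leqNgt -mem_short_words; apply: contra wF => wF.
  by rewrite mem_set.
rewrite esum_fset; [|exact: finite_seq|by move=> w _; rewrite lee_fin].
rewrite -(fsbig_seq _ _ (short_words_uniq K)) sumEFin; congr (_%:E).
exact: sum_short_words.
Qed.

(** The partial sums are constant once the index set contains all short words. *)
Lemma sum_short_words_lim K (f : seq 'I_n -> R[i]^o) :
  (forall w, (K <= size w)%N -> f w = 0) ->
  summability.sum f = \sum_(k < K) \sum_(w : k.-tuple 'I_n) f w.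
Proof.
move=> fK; rewrite -sum_short_words; apply: lim_near_cst; first exact: norm_hausdorff.
exists [fset w in short_words K]%fset => // A /= KA.
rewrite /summability.partial_sum -(big_seq_fsetE _ A xpredT f)/=.
rewrite -(big_fset_incl _ KA) => [|w _].
  rewrite (perm_big (short_words K))//=.
  apply: uniq_perm; [exact: fset_uniq|exact: short_words_uniq|].
  by move=> w; rewrite !inE.
by rewrite !inE mem_short_words -leqNgt => /fK.
Qed.

Lemma esum1_seq_le (f : seq 'I_n -> R) (r : seq (seq 'I_n)) : (forall w, 0 <= f w) ->
  (\esum_(w in [set: seq 'I_n]) (f w)%:E)%E = 1%E -> uniq r ->
  \sum_(w <- r) f w <= 1.
Proof.
move=> f0 f1 r_uniq; rewrite -lee_fin -f1; apply: esum_ge.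
exists [set` r]; first by split; [exact: finite_seq|].
by rewrite -fsbig_seq// sumEFin.
Qed.

End WordsOfBoundedLength.

(** Covers the zero space: it has no unit vectors or unit families, so the radii are suprema of the
    empty set. *)
Lemma sup_image0 {R : realType} {T : Type} (D : set T) (f : T -> R) :
  ~ (exists x, D x) -> sup [set f x | x in D] = 0.
Proof.
move=> noD; rewrite (_ : D = set0) ?image_set0 ?sup0//.
by rewrite -subset0 => x Dx; apply: noD; exists x.
Qed.

(** * The joint numerical radius and its comparison with the other radii *)

Section NumericalRadius.
Context {R : realType} {H : completeNormedModType R[i]}.
Variable dot : {dot H for Num.conj}.
Hypothesis dot_norm : forall x : H, dot x x = `|x| ^+ 2.
Context {n : nat}.
Variable T : 'I_n -> H -> H.
Hypothesis T_bounded : forall i, bounded_op (T i).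

Local Notation pairing h :=
  (fun w : seq 'I_n => \sum_(j < n) dot (h w) (T j (h (j :: w))) : R[i]^o).
Local Notation unit_family h :=
  ((\esum_(w in [set: seq 'I_n]) (rnorm (h w) ^+ 2)%:E)%E = 1%E).

Lemma row_norm_ge0 : 0 <= row_norm dot T.
Proof. exact: sqrtr_ge0. Qed.

(** Cauchy-Schwarz separates the mass of [h] on [A], at most 1, from that of the row images, at most
    the squared row norm times the mass of [h] on the words [j :: w]. These are pairwise distinct,
    so that mass is at most 1 too. *)
Lemma pairing_partial_sum_le (h : seq 'I_n -> H) (A : {fset seq 'I_n}) :
  unit_family h ->
  rnorm (summability.partial_sum (pairing h) A : R[i]) <= row_norm dot T.
Proof.
move=> h1; pose y w := \sum_(j < n) T j (h (j :: w)).
have -> : summability.partial_sum (pairing h) A =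
    \sum_(w : A) dot (h (val w)) (y (val w)).
  by apply: eq_bigr => w _; rewrite /y dot_sumr.
apply: (@le_trans _ _ (\sum_(w : A) rnorm (h (val w)) * rnorm (y (val w)))).
  rewrite (le_trans (rnorm_sum _ _ _ _ _))//; apply: ler_sum => w _.
  exact: CauchySchwarz_rnorm.
rewrite -(@ler_pXn2r _ 2) ?nnegrE ?row_norm_ge0 ?sumr_ge0//; last first.
  by move=> w _; rewrite mulr_ge0 ?rnorm_ge0.
rewrite (le_trans (CauchySchwarz_sum _ _ _))//.
have P0 : 0 <= opnorm (fun x => \sum_(i < n) T i (adjoint dot (T i) x)).
  by apply: opnorm_ge0; exact: bounded_gram.
rewrite /row_norm sqr_sqrtr// -[leRHS]mul1r.
rewrite ler_pM ?sumr_ge0 => // [w _|w _||]; rewrite ?sqr_ge0//.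
  rewrite -(big_seq_fsetE _ A xpredT (fun w => rnorm (h w) ^+ 2)).
  apply: (esum1_seq_le (fun w => rnorm (h w) ^+ 2)) => // [w|]; last exact: fset_uniq.
  exact: sqr_ge0.
apply: (@le_trans _ _ (\sum_(w : A)
    opnorm (fun x => \sum_(i < n) T i (adjoint dot (T i) x)) *
    \sum_(j < n) rnorm (h (j :: val w)) ^+ 2)).
  by apply: ler_sum => w _; exact: (row_le _ dot_norm _ T T_bounded).
rewrite -mulr_sumr ler_piMr//.
rewrite -(big_seq_fsetE _ A xpredT (fun w => \sum_(j < n) rnorm (h (j :: w)) ^+ 2)).
under eq_bigr do rewrite -big_enum/=.
rewrite -(big_allpairs_dep (h := fun (w : seq 'I_n) (j : 'I_n) => j :: w)
                           (F := fun w => rnorm (h w) ^+ 2)).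
apply: esum1_seq_le => // [w|]; first exact: sqr_ge0.
apply: allpairs_uniq; rewrite ?fset_uniq ?enum_uniq//.
by move=> [w j] [w' j'] _ _ /= [-> ->].
Qed.

Lemma pairing_sum_le (h : seq 'I_n -> H) : unit_family h ->
  rnorm (summability.sum (pairing h) : R[i]) <= row_norm dot T.
Proof.
move=> h1; set F := summability.partial_sum (pairing h) @ summability.totally.
have [Fcvg|/dvgP Fdvg] := pselect (cvg F); last first.
  (* A divergent net has the default limit 0, which satisfies the bound. *)
  by rewrite /summability.sum Fdvg rnorm0 row_norm_ge0.
apply/ler_addgt0Pr => e e0.
have /cvgrPdist_lt/(_ e%:C) := Fcvg; rewrite ltcR => /(_ e0) near_lim.
have [A] := filter_ex near_lim; rewrite rnormE ltcR => lA.
rewrite -[X in rnorm X](subrK (summability.partial_sum (pairing h) A)).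
by rewrite (le_trans (rnormD _ _ _))// addrC lerD ?pairing_partial_sum_le// ltW.
Qed.

Lemma numerical_radius_has_ub :
  has_ubound [set rnorm (summability.sum (pairing h) : R[i])
             | h in [set h : seq 'I_n -> H | unit_family h]].
Proof. by exists (row_norm dot T) => _ [h h1 <-]; exact: pairing_sum_le. Qed.

Lemma pairing_sum_le_radius (h : seq 'I_n -> H) : unit_family h ->
  rnorm (summability.sum (pairing h) : R[i]) <= numerical_radius dot T.
Proof. by move=> h1; apply: (ub_le_sup numerical_radius_has_ub); exists h. Qed.

Lemma numerical_radius_ge0 : 0 <= numerical_radius dot T.
Proof.
have [[h h1]|noh] := pselect (exists h : seq 'I_n -> H, unit_family h).
  by rewrite (le_trans _ (pairing_sum_le_radius _ h1))// rnorm_ge0.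
by rewrite /numerical_radius sup_image0.
Qed.

Lemma numerical_radius_row_norm : numerical_radius dot T <= row_norm dot T.
Proof.
have [[h h1]|noh] := pselect (exists h : seq 'I_n -> H, unit_family h).
  apply: ge_sup; first by exists (rnorm (summability.sum (pairing h))); exists h.
  by move=> _ [g g1 <-]; exact: pairing_sum_le.
by rewrite /numerical_radius sup_image0// row_norm_ge0.
Qed.

(** Homogeneous form of the definition of the radius for finite families. Levels below [K] are
    paired with the next one, so the mass runs over [K + 1] levels. *)
Lemma finite_pairing_le K (g : seq 'I_n -> H) :
  rnorm (\sum_(k < K) \sum_(w : k.-tuple 'I_n)
           \sum_(j < n) dot (g w) (T j (g (j :: w)))) <=
  numerical_radius dot T *
    \sum_(k < K.+1) \sum_(w : k.-tuple 'I_n) rnorm (g w) ^+ 2.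
Proof.
set p := \sum_(k < K) _; set s := \sum_(k < K.+1) _.
have s0 : 0 <= s.
  by apply: sumr_ge0 => k _; apply: sumr_ge0 => w _; exact: sqr_ge0.
have g0 (w : seq 'I_n) : s = 0 -> (size w <= K)%N -> g w = 0.
  rewrite /s -(sum_short_words _ _ (fun w => rnorm (g w) ^+ 2)) => s_eq0 wK.
  have ws : w \in short_words K.+1 by rewrite mem_short_words.
  apply: rnorm_eq0; apply/eqP; rewrite -sqrf_eq0; apply/eqP.
  move/eqP: s_eq0; rewrite (big_rem w)//= paddr_eq0 ?sqr_ge0//.
    by move=> /andP[/eqP].
  by apply: sumr_ge0 => v _; exact: sqr_ge0.
have [s_eq0|s_neq0] := eqVneq s 0.
  rewrite s_eq0 mulr0 /p big1 ?rnorm0// => k _; rewrite big1// => w _.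
  rewrite big1// => j _; rewrite (g0 w)// ?size_tuple ?(ltnW (ltn_ord k))//.
  by rewrite linear0l.
have s_gt0 : 0 < s by rewrite lt_neqAle eq_sym s_neq0.
pose c := Num.sqrt s^-1.
have c0 : 0 <= c by rewrite sqrtr_ge0.
have c2 : c ^+ 2 = s^-1 by rewrite sqr_sqrtr// invr_ge0.
(* Normalized and cut off above length [K], so that every pairing from level [K] on vanishes. *)
pose h (w : seq 'I_n) := if (size w <= K)%N then c%:C *: g w else 0.
have h1 : unit_family h.
  rewrite (@esum_short_words _ _ K.+1 (fun w => rnorm (h w) ^+ 2)); first last.
  - by move=> w Kw; rewrite /h leqNgt Kw rnorm0 expr0n.
  - by move=> w; exact: sqr_ge0.
  congr (_%:E); rewrite -(mulVf s_neq0) /s mulr_sumr; apply: eq_bigr => k _.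
  rewrite mulr_sumr; apply: eq_bigr => w _.
  by rewrite /h size_tuple -ltnS ltn_ord rnormZ rnormC_ge0// exprMn c2.
have := pairing_sum_le_radius _ h1.
rewrite (@sum_short_words_lim _ _ K); last first.
  move=> w Kw; rewrite big1// => j _.
  by rewrite /h /= (leqNgt _.+1) ltnS Kw/= bop0// dot0r.
have -> : \sum_(k < K) \sum_(w : k.-tuple 'I_n)
    \sum_(j < n) dot (h w) (T j (h (j :: w))) = (s^-1)%:C * p.
  rewrite /p mulr_sumr; apply: eq_bigr => k _.
  rewrite mulr_sumr; apply: eq_bigr => w _.
  rewrite mulr_sumr; apply: eq_bigr => j _.
  rewrite /h /= size_tuple (ltnW (ltn_ord k)) ltn_ord (bopZ (T_bounded j)).
  by rewrite dotZl dotZr conjc_real mulrA -rmorphM -expr2 c2.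
rewrite rnormM rnormC_ge0 ?invr_ge0// mulrC ler_pdivrMr//.
Qed.

(* The test family is [h_w = (\prod_(i <- w) nu_i) h] for [|w| <= m], where [nu]
   is the normalized conjugate of [(<T_i h, h>)_i]: each of the [m] levels
   contributes [M = |(<T_i h, h>)_i|], against a total mass of [m + 1]. *)
Lemma euclidean_radius_numerical_radius :
  euclidean_radius dot T <= numerical_radius dot T.
Proof.
have [[h0 h01]|noh] := pselect (exists h : H, rnorm h = 1); last first.
  by rewrite /euclidean_radius sup_image0// numerical_radius_ge0.
apply: ge_sup; first by eexists; exists h0.
move=> _ [h /= h1 <-]; set M := Num.sqrt _.
pose mu i := dot (T i h) h.
have [->|M0] := eqVneq M 0; first exact: numerical_radius_ge0.
have M_gt0 : 0 < M by rewrite lt_neqAle eq_sym M0 sqrtr_ge0.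
have M2 : M ^+ 2 = \sum_i rnorm (mu i) ^+ 2.
  by rewrite sqr_sqrtr// sumr_ge0// => i _; exact: sqr_ge0.
pose nu i : R[i] := (mu i)^*%C * (M^-1)%:C.
pose g (w : seq 'I_n) := (\prod_(i <- w) nu i) *: h.
have nu2 : \sum_i rnorm (nu i) ^+ 2 = 1.
  rewrite (eq_bigr (fun i => rnorm (mu i) ^+ 2 * M^-1 ^+ 2)).
    by rewrite -mulr_suml -M2; field.
  by move=> i _; rewrite rnormM rnormJ rnormC_ge0 ?exprMn// invr_ge0 ltW.
have rg (w : seq 'I_n) : rnorm (g w) ^+ 2 = \prod_(i <- w) rnorm (nu i) ^+ 2.
  by rewrite /g rnormZ h1 mulr1 rnorm_prod prodrXl.
have level k : \sum_(w : k.-tuple 'I_n) rnorm (g w) ^+ 2 = 1.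
  under eq_bigr do rewrite rg.
  by rewrite (sum_tuple_prod _ _ _ (fun i => rnorm (nu i) ^+ 2)) nu2 expr1n.
(* On the right [nu_j] enters conjugated, as [mu_j / M], against [<h, T_j h>], the conjugate of
   [mu_j]; the sum of [|mu_j|^2 / M] is [M]. *)
have pair (w : seq 'I_n) :
    \sum_(j < n) dot (g w) (T j (g (j :: w))) = (M * rnorm (g w) ^+ 2)%:C.
  transitivity (\sum_(j < n) (rnorm (g w) ^+ 2)%:C *
                  ((M^-1)%:C * (rnorm (mu j) ^+ 2)%:C)).
    apply: eq_bigr => j _; rewrite /g big_cons -scalerA.
    set z := \prod_(i <- w) nu i.
    rewrite (bopZ (T_bounded j)) (bopZ (T_bounded j)) dotZl !dotZr.
    rewrite rnormZ h1 mulr1 sqr_rnorm sqr_rnorm (dotC h) -/(mu j).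
    have -> : (nu j)^*%C = mu j * (M^-1)%:C.
      rewrite /nu rmorphM; congr (_ * _); last exact: conjc_real.
      exact: conjcK.
    by ring.
  rewrite -!mulr_sumr -rmorph_sum -M2 -!rmorphM; congr (_%:C).
  by field.
have main m : m%:R * M <= numerical_radius dot T * m.+1%:R.
  have := finite_pairing_le m g.
  under [X in _ * X]eq_bigr do rewrite level.
  rewrite sumr_const card_ord -mulr_natl mulr1.
  rewrite (eq_bigr (fun=> M%:C)) => [|k _].
    rewrite sumr_const card_ord -(rmorphMn (real_complex R)) -mulr_natl.
    by rewrite rnormC_ge0// mulr_ge0// ltW.
  under eq_bigr do rewrite pair.
  by rewrite -rmorph_sum -mulr_sumr level mulr1.
rewrite leNgt; apply/negP => WM.
have W0 := numerical_radius_ge0.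
set W := numerical_radius dot T in main WM W0.
have d0 : 0 < M - W by rewrite subr_gt0.
(* [main] reads [m (M - W) <= W], which fails for [m > W / (M - W)]. *)
have := main (Num.trunc (W / (M - W))).+1.
set m := Num.trunc _.
have : W / (M - W) < m.+1%:R by rewrite truncnS_gt.
rewrite ltr_pdivrMr// -[m.+2%:R]natr1; nra.
Qed.

(* For [x] supported at level [k], the test family is [h_w = s^p (B^p x)_w] at
   level [k - p], where [(B f)_w = \sum_j T_j f_(j w)] and [1 / s = w + e]: the
   pairing of levels [k - p] and [k - p + 1] is [s^(-1)] times the mass of level
   [k - p], which bounds the mass of level [0], that is of [T_w x_w] summed. *)
Lemma gram_norm_numerical_radius k (e : R) : 0 < e ->
  gram_norm dot T k <=
  (numerical_radius dot T + e) / e * (numerical_radius dot T + e) ^+ (2 * k).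
Proof.
move=> e0; set W := numerical_radius dot T.
have W0 : 0 <= W := numerical_radius_ge0.
have We : 0 < W + e by rewrite ltr_wpDl.
apply: gram_norm_le => // [|x0]; first by rewrite mulr_ge0 ?exprn_ge0 ?divr_ge0 ?ltW.
(* Iterating [B] composes the operators in the order opposite to the letters; the reversal
   compensates. *)
pose x w := x0 (rev w).
pose B (f : seq 'I_n -> H) w := \sum_(j < n) T j (f (j :: w)).
have BE p f w : iter p B f w =
    \sum_(v : p.-tuple 'I_n) word_op T (rev v) (f (v ++ w)).
  elim: p f => [|p IH] f.
    by rewrite (sum_tuple0 (fun v => word_op T (rev v) (f (v ++ w)))).
  rewrite iterSr IH (sum_tupleS p (fun v => word_op T (rev v) (f (v ++ w)))).
  rewrite exchange_big/=; apply: eq_bigr => v _.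
  rewrite (bop_sum _ _ _ _ (bounded_word_op _ T_bounded _)).
  by apply: eq_bigr => j _; rewrite rev_cons -cats1 word_op_cat.
pose s := (W + e)^-1.
have s0 : 0 < s by rewrite invr_gt0.
pose g w := (s ^+ (k - size w))%:C *: iter (k - size w) B x w.
pose t m := \sum_(w : m.-tuple 'I_n) rnorm (g w) ^+ 2.
have t0 m : 0 <= t m by apply: sumr_ge0 => w _; exact: sqr_ge0.
have pair m : (m < k)%N ->
    \sum_(w : m.-tuple 'I_n) \sum_(j < n) dot (g w) (T j (g (j :: w))) =
    ((W + e) * t m)%:C.
  move=> mk; rewrite /t mulr_sumr rmorph_sum/=; apply: eq_bigr => w _.
  rewrite -dot_sumr.
  have -> : \sum_(j < n) T j (g (j :: w)) = (W + e)%:C *: g w.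
    rewrite /g /= size_tuple -[in RHS](subnSK mk) exprS iterS /B.
    rewrite scalerA -rmorphM mulrA mulfV ?gt_eqF// mul1r scaler_sumr.
    by apply: eq_bigr => j _; rewrite (bopZ (T_bounded j)).
  by rewrite dotZr conjc_real (dotxx dot_norm) -rmorphM.
have := finite_pairing_le k g; rewrite big_ord_recr/= -!/(t _).
rewrite (eq_bigr (fun m : 'I_k => ((W + e) * t m)%:C)) => [|m _]; last exact: pair.
rewrite -rmorph_sum -mulr_sumr rnormC_ge0; last by rewrite mulr_ge0 ?sumr_ge0 ?ltW.
rewrite -/W; set S := \sum_(m < k) t m => key.
have tS : t 0%N <= S + t k.
  have -> : S + t k = \sum_(m < k.+1) t m by rewrite big_ord_recr.
  by rewrite big_ord_recl lerDl sumr_ge0.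
have tk : t k = \sum_(w : k.-tuple 'I_n) rnorm (x0 w) ^+ 2.
  rewrite /t -(sum_tuple_rev k (fun w => rnorm (x0 w) ^+ 2)).
  by apply: eq_bigr => w _; rewrite /g size_tuple subnn scale1r.
have te : t 0%N =
    s ^+ (2 * k) * rnorm (\sum_(w : k.-tuple 'I_n) word_op T w (x0 w)) ^+ 2.
  rewrite /t (sum_tuple0 (fun w => rnorm (g w) ^+ 2)) /g subn0 BE.
  rewrite rnormZ rnormC_ge0 ?exprn_ge0 ?(ltW s0)// exprMn -exprM mulnC.
  congr (_ * rnorm _ ^+ 2).
  rewrite -(sum_tuple_rev k (fun w => word_op T w (x0 w))).
  by apply: eq_bigr => w _; rewrite cats0.
(* [key] gives [e S <= W (t k)], and [t 0 <= S + t k]. *)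
have : e * t 0%N <= (W + e) * t k by nra.
rewrite te tk mulrCA -ler_pdivlMl ?exprn_gt0// /s exprVn invrK => h.
rewrite -[leLHS]mulr1 -(mulfV (lt0r_neq0 e0)) mulrA ler_pdivrMr// mulrC.
rewrite (le_trans h)// le_eqVlt; apply/orP; left; apply/eqP; field.
exact: lt0r_neq0.
Qed.

(** The factor [(w + e) / e] does not depend on [k], so it disappears in the limit of the [2 k]-th
    roots; then [e] is arbitrary. *)
Lemma spectral_radius_numerical_radius :
  spectral_radius dot T <= numerical_radius dot T.
Proof.
apply/ler_addgt0Pr => e e0.
apply: (spectral_radius_le _ dot_norm _ T_bounded) => [|k].
  by rewrite ltr_wpDl// numerical_radius_ge0.
exact: gram_norm_numerical_radius.
Qed.

End NumericalRadius.

(** * The joint numerical range and the Euclidean radius *)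

Section NumericalRange.
Context {R : realType} {H : completeNormedModType R[i]}.
Variable dot : {dot H for Num.conj}.
Hypothesis dot_norm : forall x : H, dot x x = `|x| ^+ 2.
Context {n : nat}.
Variable T : 'I_n -> H -> H.
Hypothesis T_bounded : forall i, bounded_op (T i).

(* If l is in the right spectrum, the adjoints of the operators l_i - T_i are
   not jointly bounded below, and a unit vector h which they almost annihilate
   has (<T_i h, h>)_i close to l. *)
Lemma right_spectrum_numerical_range :
  right_spectrum T `<=` closure (numerical_range dot T).
Proof.
move=> l sl B /nbhs_rV[e e0 eB].
pose A i x := l 0 i *: x - T i x.
have A_bounded i : bounded_op (A i) := bounded_resolvent T T_bounded l i.
have [h h1 hA] : exists2 h : H, rnorm h = 1 &
    \sum_i rnorm (adjoint dot (A i) h) ^+ 2 < e ^+ 2.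
  apply: contrapT => noh; apply: (iffRL (right_spectrumPn T T_bounded l)) sl.
  have e2_gt0 : 0 < e ^+ 2 by rewrite exprn_gt0.
  have [|X XA] := row_right_inverse dot dot_norm _ A A_bounded _ e2_gt0;
    last by exists X.
  move=> x.
  have [x0|x0] := eqVneq (rnorm x) 0.
    by rewrite x0 expr0n mulr0 sumr_ge0// => i _; exact: sqr_ge0.
  have {}x0 : 0 < rnorm x by rewrite lt_neqAle eq_sym x0 rnorm_ge0.
  rewrite leNgt; apply/negP => xA; apply: noh; exists ((rnorm x)^-1%:C *: x).
    by rewrite rnormZ rnormC_ge0 ?invr_ge0 ?rnorm_ge0// mulVf// gt_eqF.
  rewrite (eq_bigr (fun i => (rnorm x)^-1 ^+ 2 * rnorm (adjoint dot (A i) x) ^+ 2)).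
    by rewrite -mulr_sumr exprVn ltr_pdivrMl ?exprn_gt0// mulrC.
  move=> i _; rewrite (bopZ (bounded_adjoint dot dot_norm _ A A_bounded i)).
  by rewrite rnormZ rnormC_ge0 ?invr_ge0 ?rnorm_ge0// exprMn.
exists (\row_i dot (T i h) h); split; first by exists h.
apply: eB => i; rewrite mxE.
(* Because [|h| = 1], each coordinate difference is [<A_i h, h>], bounded by the norm of the adjoint
   of [A_i] at [h]. *)
have -> : l 0 i - dot (T i h) h = dot (A i h) h :> R[i].
  by rewrite /A dotBl dotZl (dotxx dot_norm) h1 expr1n mulr1.
rewrite (dot_adjoint dot dot_norm _ A A_bounded).
rewrite (le_lt_trans (CauchySchwarz_rnorm dot_norm _ _))// h1 mul1r.
rewrite -(@ltr_pXn2r _ 2) ?nnegrE ?rnorm_ge0 ?(ltW e0)//.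
rewrite (le_lt_trans _ hA)// (bigD1 i)//= lerDl sumr_ge0// => j _.
exact: sqr_ge0.
Qed.

(** Cauchy-Schwarz bounds each coordinate by [opnorm (T i)]; boundedness places each value at a unit
    vector below the [sup]. *)
Lemma euclidean_radius_has_ub :
  has_ubound [set Num.sqrt (\sum_i rnorm (dot (T i h) h) ^+ 2)
             | h in [set h : H | rnorm h = 1]].
Proof.
exists (Num.sqrt (\sum_i opnorm (T i) ^+ 2)) => _ [h /= h1 <-].
rewrite ler_wsqrtr//; apply: ler_sum => i _.
rewrite ler_pXn2r ?nnegrE ?rnorm_ge0 ?opnorm_ge0//.
rewrite (le_trans (CauchySchwarz_rnorm dot_norm _ _))// h1 mulr1.
by rewrite (le_trans (le_opnorm _ _ (T_bounded i)))// h1 mulr1.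
Qed.

Lemma euclidean_radius_ge0 : 0 <= euclidean_radius dot T.
Proof.
have [[h h1]|noh] := pselect (exists h : H, rnorm h = 1).
  apply: (le_trans (sqrtr_ge0 (\sum_i rnorm (dot (T i h) h) ^+ 2))).
  by apply: (ub_le_sup euclidean_radius_has_ub); exists h.
by rewrite /euclidean_radius sup_image0.
Qed.

Lemma numerical_range_closed_ball :
  numerical_range dot T `<=` closed_ball_Cn (euclidean_radius dot T).
Proof.
move=> _ [h h1 <-]; rewrite /closed_ball_Cn/=.
under eq_bigr do rewrite mxE.
rewrite -[leLHS]sqr_sqrtr ?sumr_ge0// => [|i _]; last exact: sqr_ge0.
rewrite ler_pXn2r ?nnegrE ?sqrtr_ge0 ?euclidean_radius_ge0//.
by apply: (ub_le_sup euclidean_radius_has_ub); exists h.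
Qed.

End NumericalRange.

(** * Assembly of the inclusions and of compactness *)

Theorem theorem3p1 (R : realType) (H : completeNormedModType R[i])
    (dot : {dot H for Num.conj}) (dot_norm : forall x : H, dot x x = `|x| ^+ 2)
    (n : nat) (n_gt0 : (0 < n)%N)
    (T : 'I_n -> H -> H) (T_bounded : forall i, bounded_op (T i)) :
  [/\ [/\ right_spectrum T `<=` closure (numerical_range dot T),
          closure (numerical_range dot T)
            `<=` closed_ball_Cn (euclidean_radius dot T),
          @closed_ball_Cn R n (euclidean_radius dot T)
            `<=` closed_ball_Cn (numerical_radius dot T) &
          @closed_ball_Cn R n (numerical_radius dot T)
            `<=` closed_ball_Cn (row_norm dot T)],
      right_spectrum T `<=` closed_ball_Cn (spectral_radius dot T) /\
        @closed_ball_Cn R n (spectral_radius dot T)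
          `<=` closed_ball_Cn (numerical_radius dot T) &
      compact (right_spectrum T)].
Proof.
have spectrum_ball := right_spectrum_spectral_radius dot dot_norm T T_bounded.
have r_ge0 := spectral_radius_ge0 dot dot_norm T T_bounded.
split; [split|split|].
- exact: right_spectrum_numerical_range.
- move=> l /(closure_subset (numerical_range_closed_ball dot dot_norm T T_bounded)).
  exact/closure_closed_ball/euclidean_radius_ge0.
- apply: closed_ball_subset; first exact: euclidean_radius_ge0.
  exact: euclidean_radius_numerical_radius.
- apply: closed_ball_subset; first exact: numerical_radius_ge0.
  exact: numerical_radius_row_norm.
- exact: spectrum_ball.
- by apply: closed_ball_subset => //; exact: spectral_radius_numerical_radius.
- apply: closed_subball_compact spectrum_ball => //.
  exact: right_spectrum_closed.
Qed.
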